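(* Let $K$ be the Sierpinski gasket with its standard energy form $(\mathcal{E},\mathcal{D}(\mathcal{E}))$ and let $\mu$ be an atom free nonnegative Radon measure on $K$ with full support. Let $u_0=\partial h_0$ with $h_0\in\mathcal{D}(\mathcal{E})$ and let $u(t)$, $t\ge 0$, be the unique solution (in the sense specified in the context) to the vector Burgers Cauchy problem with initial condition $u_0$, that is, $u(t)=-2\,\partial\log w(t)$ with $w(t)=e^{t\mathcal{L}}e^{-h_0/2}$. Assume in addition that $h_0(x_0)=0$ for some $x_0\in K$. (i) We have $$\sup_{t>0}\|u(t)\|_{\mathcal{H}}\le c_1\|u_0\|_{\mathcal{H}}\,e^{c_2\|u_0\|_{\mathcal{H}}}$$ with positive constants $c_1$ and $c_2$ independent of $u_0$. (ii) If $\widetilde u_0=\partial\widetilde h_0$ is another initial condition with $\widetilde h_0\in\mathcal{D}(\mathcal{E})$ such that $\widetilde h_0(x_0)=0$, and $\widetilde u$ is the corresponding solution, then $$\sup_{t>0}\|u(t)-\widetilde u(t)\|_{\mathcal{H}}\le c_3(\|u_0\|_{\mathcal{H}}+1)^2e^{c_4(\|u_0\|_{\mathcal{H}}+\|\widetilde u_0\|_{\mathcal{H}})}\|u_0-\widetilde u_0\|_{\mathcal{H}}$$ with positive constants $c_3$ and $c_4$ independent of $u_0$ and $\widetilde u_0$.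
   Context: Sierpinski gasket and energy. Let $q_0,q_1,q_2\in\mathbb{R}^2$ be the vertices of an equilateral triangle of side length $1$, $F_i(x)=\frac12(x-q_i)+q_i$, and $K$ the unique nonempty compact set with $K=\bigcup_{i=0}^2F_i(K)$. Put $V_0=\{q_0,q_1,q_2\}$, $F_w=F_{w_1}\circ\dots\circ F_{w_m}$ for words $w=w_1\dots w_m\in\{0,1,2\}^m$, $V_m=\bigcup_{|w|=m}F_wV_0$, $V_\ast=\bigcup_mV_m$. For distinct $p,q\in V_m$ write $p\sim_mq$ if $p,q\in F_wV_0$ for some $|w|=m$. With $r=\frac35$ put $\mathcal{E}_m(f)=r^{-m}\sum_{p\in V_m}\sum_{q\sim_mp}(f(p)-f(q))^2$ and $\mathcal{E}(f)=\lim_{m\to\infty}\mathcal{E}_m(f)$ (a nondecreasing limit) for $f:V_\ast\to\mathbb{R}$. Functions on $V_\ast$ with $\mathcal{E}(f)<\infty$ extend uniquely to continuous functions on $K$; $\mathcal{D}(\mathcal{E})$ is the space of all continuous $f:K\to\mathbb{R}$ with $\mathcal{E}(f):=\mathcal{E}(f|_{V_\ast})<\infty$. It is an algebra under pointwise multiplication. Vector fields. For $f,g\in\mathcal{D}(\mathcal{E})$ put $\overline g(x,y)=\frac12(g(x)+g(y))$, $d_uf(x,y)=f(x)-f(y)$, $(g\,d_uf)(x,y)=\overline g(x,y)d_uf(x,y)$ on $K\times K$. On the linear span of all functions $g\,d_uf$ define, by bilinear extension, the nonnegative definite symmetric form $$\langle g_1d_uf_1,g_2d_uf_2\rangle_{\mathcal{H}}=\lim_{m\to\infty}r^{-m}\sum_{p\in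 V_m}\sum_{q\sim_mp}\overline{g_1}(p,q)\,\overline{g_2}(p,q)\,d_uf_1(p,q)\,d_uf_2(p,q).$$ $\mathcal{H}$ is the Hilbert space obtained by factoring out zero seminorm elements and completing. There is an action of $\mathcal{D}(\mathcal{E})$ on $\mathcal{H}$, $(g,v)\mapsto gv$, induced by $(g\,v)(x,y)=\overline g(x,y)v(x,y)$, with $\|gv\|_{\mathcal{H}}\le\|g\|_{\sup}\|v\|_{\mathcal{H}}$. $\partial:\mathcal{D}(\mathcal{E})\to\mathcal{H}$ sends $f$ to the class of $d_uf$; $\|\partial f\|_{\mathcal{H}}^2=\mathcal{E}(f)$ and $\partial(fg)=f\partial g+g\partial f$. Operators. $(\mathcal{E},\mathcal{D}(\mathcal{E}))$ is a local regular Dirichlet form on $L^2(K,\mu)$; $\mathcal{L}$ denotes its generator, the nonpositive self-adjoint operator with $\mathcal{E}(f,g)=-\langle\mathcal{L}f,g\rangle_{L^2(K,\mu)}$, and $e^{t\mathcal{L}}$ the associated semigroup. $\partial$ is a densely defined closed operator from $L^2(K,\mu)$ to $\mathcal{H}$ with domain $\mathcal{D}(\mathcal{E})$; $\partial^\ast$ is its adjoint, with domain $\mathcal{D}(\partial^\ast)\subset\mathcal{H}$. The vector Laplacian is $\vec{\mathcal{L}}v=-\partial\partial^\ast v$ with domain $\mathcal{D}(\vec{\mathcal{L}})=\{v\in\mathcal{D}(\partial^\ast):\partial^\ast v\in\mathcal{D}(\mathcal{E})\}$. For $u\in\mathcal{H}$, $\partial\langle u,u\rangle$ is the functional $\partial\langle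 u,u\rangle(v)=\langle(\partial^\ast v)u,u\rangle_{\mathcal{H}}$, $v\in\mathcal{D}(\vec{\mathcal{L}})$. Vector Burgers Cauchy problem and solution. The problem is $u_t(t)=\vec{\mathcal{L}}u(t)-\frac12\partial\langle u,u\rangle(t)$, $t>0$, $u(0)=u_0$. A function $u\in C([0,+\infty),\mathcal{H})\cap C^1((0,+\infty),\mathcal{H})$ is a solution with initial condition $u_0\in\mathcal{H}$ if $u(0)=u_0$ in $\mathcal{H}$ and for all $t>0$ and all $v\in\mathcal{D}(\vec{\mathcal{L}})$ $$\langle u_t(t),v\rangle_{\mathcal{H}}=-\langle u(t),\partial\partial^\ast v\rangle_{\mathcal{H}}-\tfrac12\langle(\partial^\ast v)u(t),u(t)\rangle_{\mathcal{H}}.$$ For initial conditions $u_0=\partial h_0$, $h_0\in\mathcal{D}(\mathcal{E})$, the solution exists, is unique, and is given by the formula in the claim. *)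

(* Defs.v *)
From HB Require Import structures.
From mathcomp Require Import all_boot all_order all_algebra.
From mathcomp Require Import all_classical all_reals all_analysis.

Set Implicit Arguments.
Unset Strict Implicit.
Unset Printing Implicit Defensive.

Import Order.TTheory GRing.Theory Num.Theory.
Import numFieldNormedType.Exports.

Local Open Scope classical_set_scope.
Local Open Scope ring_scope.

Definition similarity (R : realType) (c x : 'rV[R]_2) : 'rV[R]_2 :=
  2^-1 *: (x - c) + c.

Structure gasket (R : realType) := Gasket {
  vertex : 'I_3 -> 'rV[R]_2 ;
  vertex_dist1 : forall i j, i != j ->
    Num.sqrt (\sum_(k < 2) (vertex i 0 k - vertex j 0 k) ^+ 2) = 1 ;
  gasket_set : set 'rV[R]_2 ;
  gasket_nonempty : gasket_set !=set0 ;
  gasket_compact : compact gasket_set ;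
  gasket_self_similar :
    gasket_set = \bigcup_(i in [set: 'I_3]) (similarity (vertex i) @` gasket_set)
}.

Definition gpoint (R : realType) (K : gasket R) : Type := set_type (gasket_set K).

Section GasketPoints.
Variables (R : realType) (K : gasket R).

HB.instance Definition _ := Topological.copy (gpoint K) (set_type (gasket_set K)).

Definition gasket_default : gpoint K :=
  let: exist x Kx := cid (gasket_nonempty K) in exist _ x (mem_set Kx).

HB.instance Definition _ := isPointed.Build (gpoint K) gasket_default.

End GasketPoints.

Definition borel (R : realType) (K : gasket R) :=
  g_sigma_algebraType (@open (gpoint K)).

Section Energy.
Variables (R : realType) (K : gasket R).
Local Notation X := (gpoint K).

Definition word_map (w : seq 'I_3) (x : 'rV[R]_2) : 'rV[R]_2 :=
  foldr (fun i => similarity (vertex K i)) x w.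

Definition in_cell (w : seq 'I_3) (p : X) : Prop :=
  exists i, set_val p = word_map w (vertex K i).

Definition vertices (m : nat) : set X :=
  [set p | exists2 w, size w = m & in_cell w p].

Definition neighbours (m : nat) (p : X) : set X :=
  [set q | q <> p /\ exists w, [/\ size w = m, in_cell w p & in_cell w q]].

Definition graph_sum (m : nat) (a : X * X -> R) : R :=
  (3 / 5) ^- m * \sum_(p \in vertices m) \sum_(q \in neighbours m p) a (p, q).

Definition du (f : X -> R) : X * X -> R := fun z => f z.1 - f z.2.

Definition mean (g : X -> R) : X * X -> R := fun z => 2^-1 * (g z.1 + g z.2).

Definition energy (f : X -> R) : \bar R :=
  limn (fun m => (graph_sum m (fun z => (f z.1 - f z.2) ^+ 2))%:E).

Definition Edom (f : X -> R) : Prop := continuous f /\ (energy f < +oo)%E.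

Definition field_form (a b : X * X -> R) : R :=
  limn (fun m => graph_sum m (a \* b)).

Definition energy_form (f g : X -> R) : R := field_form (du f) (du g).

Definition field_span (a : X * X -> R) : Prop :=
  exists (n : nat) (c : 'I_n -> R) (g f : 'I_n -> X -> R),
    (forall i, Edom (g i) /\ Edom (f i)) /\
    a = \sum_(i < n) c i *: (mean (g i) \* du (f i)).

End Energy.

(* A Hilbert space completion of [field_span] modulo zero seminorm elements;
   it is unique up to isometric isomorphism.  [vf_class a] is the class of a,
   meaningful only when a is in [field_span]. *)
Structure vector_fields (R : realType) (K : gasket R) := VectorFields {
  vf_space :> completeNormedModType R ;
  vf_ip : vf_space -> vf_space -> R ;
  vf_ipC : forall u v, vf_ip u v = vf_ip v u ;
  vf_ip_linear : forall c u v w,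
    vf_ip (c *: u + v) w = c * vf_ip u w + vf_ip v w ;
  vf_ip_norm : forall u, vf_ip u u = `|u| ^+ 2 ;
  vf_class : (gpoint K * gpoint K -> R) -> vf_space ;
  vf_class_linear : forall c a b, field_span a -> field_span b ->
    vf_class (c *: a + b) = c *: vf_class a + vf_class b ;
  vf_class_ip : forall a b, field_span a -> field_span b ->
    vf_ip (vf_class a) (vf_class b) = field_form a b ;
  vf_class_dense : closure [set vf_class a | a in @field_span R K] = setT
}.

Section VectorFields.
Variables (R : realType) (K : gasket R) (H : vector_fields K).
Local Notation X := (gpoint K).

Definition grad (f : X -> R) : H := vf_class H (du f).

(* The product of the pointwise average of g with a in [field_span] need not be
   in [field_span], but it is at zero seminorm distance from an element of it:
   mean g * (mean g1 * du f) is equivalent to mean (g * g1) * du f.  Hence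
   [represents_mul g a b] says that the class of b is that of (mean g) a, and
   [vf_act g] is the continuous extension to H of the map sending the class of
   such an a to that of b. *)
Definition represents_mul (g : X -> R) (a b : X * X -> R) : Prop :=
  graph_sum m (fun z => (b z - mean g z * a z) ^+ 2) @[m --> \oo] --> (0 : R).

Definition vf_act (g : X -> R) (v : H) : H :=
  get [set w : H | forall a b : nat -> X * X -> R,
    (forall n, field_span (a n) /\ field_span (b n)) ->
    (forall n, represents_mul g (a n) (b n)) ->
    vf_class H (a n) @[n --> \oo] --> v ->
    vf_class H (b n) @[n --> \oo] --> w].

End VectorFields.

Section Operators.
Variables (R : realType) (K : gasket R).
Variable mu : {finite_measure set (borel K) -> \bar R}.
Local Notation X := (gpoint K).

(* On the compact metric space K, the Radon measures are exactly the finite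
   Borel measures, and such a measure has no atom iff it charges no point. *)
Definition atom_free : Prop := forall x : X, mu [set x] = 0%E.

Definition full_support : Prop :=
  forall U : set X, open U -> U !=set0 -> (0 < mu U)%E.

(* Elements of L^2(K, mu) are handled through representatives. *)
Definition L2 (f : X -> R) : Prop := (f : borel K -> R) \in Lfun mu 2%:E.

Definition L2norm (f : X -> R) : \bar R := 'N[mu]_2%:E[EFin \o (f : borel K -> R)]%E.

Definition L2ip (f g : X -> R) : R := \int[mu]_x (f x * g x).

(* The graph of the generator: f is in the domain, and its image is g. *)
Definition generator (f g : X -> R) : Prop :=
  L2 g /\ exists f0 : X -> R,
    [/\ Edom f0, (f : borel K -> R) = f0 %[ae mu]
      & forall phi, Edom phi -> energy_form f0 phi = - L2ip g phi].

(* On L^2 classes: the strongly continuous contraction semigroup whose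
   infinitesimal generator is the operator with graph [generator].  The fields
   heat_linear and heat_contraction make T t compatible with a.e. equality. *)
Record heat_semigroup (T : R -> (X -> R) -> X -> R) : Prop := HeatSemigroup {
  heat_L2 : forall (t : R) f, 0 <= t -> L2 f -> L2 (T t f) ;
  heat_linear : forall (t c : R) f g, 0 <= t -> L2 f -> L2 g ->
    (T t (c *: f + g) : borel K -> R) = c *: T t f + T t g %[ae mu] ;
  heat_contraction : forall (t : R) f, 0 <= t -> L2 f ->
    (L2norm (T t f) <= L2norm f)%E ;
  heat0 : forall f, L2 f -> (T 0 f : borel K -> R) = f %[ae mu] ;
  heatD : forall (s t : R) f, 0 <= s -> 0 <= t -> L2 f ->
    (T (s + t) f : borel K -> R) = T s (T t f) %[ae mu] ;
  heat_continuous : forall f, L2 f ->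
    L2norm (T t f - f) @[t --> (0 : R)^'+] --> 0%E ;
  heat_generator : forall f g, L2 f -> L2 g ->
    (L2norm (t^-1 *: (T t f - f) - g) @[t --> (0 : R)^'+] --> 0%E)
    <-> generator f g
}.

Variable H : vector_fields K.

(* The graph of the adjoint of grad: v is in the domain, and its image is g. *)
Definition grad_adjoint (v : H) (g : X -> R) : Prop :=
  L2 g /\ forall f, Edom f -> vf_ip (grad H f) v = L2ip f g.

(* The test fields are the v in the domain of the vector Laplacian, i.e. those
   for which grad_adjoint v has a representative g in D(E), which is then unique
   when mu has full support. *)
Definition burgers_solution (u0 : H) (u : R -> H) : Prop :=
  [/\ {within `[0, +oo[, continuous u},
      (forall t : R, 0 < t -> derivable u t 1),
      {within `]0, +oo[, continuous (derive1 u)},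
      u 0 = u0
    & forall (t : R) v g, 0 < t -> grad_adjoint v g -> Edom g ->
        vf_ip (derive1 u t) v =
        - vf_ip (u t) (grad H g) - 2^-1 * vf_ip (vf_act g (u t)) (u t)].

(* u(t) = -2 grad (log w(t)), where w(t) is the representative in D(E) of
   T_t exp(-h0/2). *)
Definition cole_hopf (T : R -> (X -> R) -> X -> R) (h0 : X -> R) (u : R -> H) :
    Prop :=
  forall t : R, 0 <= t -> exists w : X -> R,
    [/\ Edom w,
        (w : borel K -> R) = T t (fun x => expR (- (h0 x / 2))) %[ae mu]
      & u t = (- 2) *: grad H (fun x => ln (w x))].

End Operators.

(* Main.v *)
Require Import Defs.
From HB Require Import structures.
From mathcomp Require Import all_boot all_order all_algebra.
From mathcomp Require Import all_classical all_reals all_analysis.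
From mathcomp Require Import measurable_realfun ring lra.
Import Order.TTheory GRing.Theory Num.Theory.
Import numFieldNormedType.Exports.
Local Open Scope classical_set_scope.
Local Open Scope ring_scope.
Set Implicit Arguments.
Unset Strict Implicit.

(** The Cole-Hopf formula reduces both estimates to the heat flow: the norm of
grad f in H is the square root of the energy of f, so u(t) = -2 grad (ln w(t))
is controlled by the energy of ln w(t) with w(t) the heat flow of exp(-h0/2).
Three facts then suffice.

Oscillation. A function of finite energy changes along an edge of level m by at
most (3/5)^(m/2) times the square root of its energy. Summing over levels bounds
its oscillation on a cell ([cell_osc]), hence on the whole gasket
([energy_osc]). As h0 vanishes at one point, |h0| <= C |grad h0|.

Heat flow. It decreases the energy ([heat_energy_le]) and obeys the maximum
principle ([heat_lower_bound]). Thus w(t) stays above exp(-C |grad h0| / 2), and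
its energy is at most that of exp(-h0/2).

Chain and product rules. The increments of a composite function are dominated by
those of its arguments, and a comparison of increments is a comparison of
energies ([energy_dominated]). This gives (i) at once; for (ii) the same rules
apply to ln (w / w'), where w / w' = 1 + (w - w') / w' and w - w' is the heat
flow of the difference of the initial values ([ln_state_dist]).

The heat flow is known only as a contraction semigroup on L2 whose generator is
that of the form. Along the orbit of a function f in the domain of the
generator, both the energy and the squared norm of (c - v)^+ are convex
functionals, and the form makes their derivatives along the flow nonpositive. A
step of the semigroup is a backward Euler step up to an error that is uniform
along the orbit ([heat_backward_step]), so that convexity turns this into
monotonicity ([energy_orbit_le], [deficit_orbit_le]). A general f of finite
energy is approximated in L2 by its resolvents, which do not increase the energy
([generator_approx]); they are found as minimisers of the energy plus a multiple
of the squared distance to f, which exist because the form is closed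
([form_complete]). Monotonicity passes to the limit because functions of bounded
energy are equicontinuous ([energy_equicontinuous]): with a measure of full
support, L2 convergence becomes pointwise, and graph energies are continuous for
pointwise convergence ([energy_lsc]). *)

(** * Cells, corners and graph sums *)

Section Geometry.
Variables (R : realType) (K : gasket R).
Local Notation q := (vertex K).

Definition sqdist (x y : 'rV[R]_2) : R := \sum_(k < 2) (x 0 k - y 0 k) ^+ 2.

(** Barycentric coordinates with respect to the three vertices. The squared terms
in x cancel, so this is affine, and its values at the vertices follow from the
side lengths alone. *)
Definition bary (j : 'I_3) (x : 'rV[R]_2) : R :=
  3^-1 + 3^-1 * (\sum_(k < 3) sqdist x (q k)) - sqdist x (q j).

Lemma sqdist_vertex i j : sqdist (q i) (q j) = (i != j)%:R.
Proof.
have [<-|ne] := eqVneq i j.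
  by rewrite /sqdist big1 // => k _; rewrite subrr expr0n.
have ge0 : 0 <= sqdist (q i) (q j) by apply: sumr_ge0 => k _; apply: sqr_ge0.
by rewrite -[LHS]sqr_sqrtr // (vertex_dist1 K ne) expr1n.
Qed.

Lemma bary_vertex i j : bary j (q i) = (i == j)%:R.
Proof.
rewrite /bary !big_ord_recl big_ord0 !sqdist_vertex.
case: i => [[|[|[|//]]] hi]; case: j => [[|[|[|//]]] hj] /=; by field.
Qed.

Lemma sum_bary x : \sum_(j < 3) bary j x = 1.
Proof. rewrite /bary !big_ord_recl !big_ord0; by field. Qed.

Lemma bary_midpoint j c x : bary j (similarity c x) = 2^-1 * (bary j x + bary j c).
Proof.
rewrite /bary /sqdist !big_ord_recl !big_ord0 /similarity !mxE; by field.
Qed.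

Lemma bary_similarity i j x :
  bary j (similarity (q i) x) = 2^-1 * (bary j x + (i == j)%:R).
Proof. by rewrite bary_midpoint bary_vertex. Qed.

Lemma similarity_center (c : 'rV[R]_2) : similarity c c = c.
Proof. by rewrite /similarity subrr scaler0 add0r. Qed.

Lemma similarityC (c d : 'rV[R]_2) : similarity c d = similarity d c.
Proof.
by rewrite /similarity; apply/matrixP => i j; rewrite !mxE; field.
Qed.

Lemma similarity_inj (c : 'rV[R]_2) : injective (similarity c).
Proof.
move=> x y /addIr /(scalerI _) /addIr; apply.
by rewrite invr_eq0 pnatr_eq0.
Qed.

Lemma word_map_rcons w k x :
  word_map K (rcons w k) x = word_map K w (similarity (q k) x).
Proof. by rewrite /word_map foldr_rcons. Qed.

Lemma word_map_cat w w' x :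
  word_map K (w ++ w') x = word_map K w (word_map K w' x).
Proof. by rewrite /word_map foldr_cat. Qed.

Lemma word_mapB w x y :
  word_map K w x - word_map K w y = 2^-1 ^+ size w *: (x - y).
Proof.
elim: w => [|i w IH] /=; first by rewrite expr0 scale1r.
rewrite exprS -scalerA -IH /similarity opprD addrACA subrr addr0 -scalerBr.
by congr (_ *: _); rewrite opprB addrA addrNK.
Qed.

Lemma word_map_nseq n i : word_map K (nseq n i) (q i) = q i.
Proof. by elim: n => //= n ->; apply: similarity_center. Qed.

Lemma bary_word_ge0 w i j : 0 <= bary j (word_map K w (q i)).
Proof.
elim: w => [|k w IH] /=; first by rewrite bary_vertex ler0n.
by rewrite bary_similarity mulr_ge0 // ?invr_ge0 ?ler0n // addr_ge0 // ler0n.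
Qed.

Lemma word_map_inj w : injective (word_map K w).
Proof. by elim: w => [|i w IH] x y //= /similarity_inj /IH. Qed.

Lemma vertex_inj : injective q.
Proof.
move=> i j e; have := bary_vertex i j; rewrite e bary_vertex eqxx.
by case: eqP => // _ /eqP; rewrite oner_eq0.
Qed.

(** A point of the cells of two different letters has weight at least 1/2 in both
coordinates, hence no weight in the third: such cells meet in at most one
point. *)
Lemma corner_bary_half i j w w' k l :
  i != j -> similarity (q i) (word_map K w (q k)) =
            similarity (q j) (word_map K w' (q l)) ->
  forall m, bary m (similarity (q i) (word_map K w (q k))) =
     2^-1 * ((i == m)%:R + (j == m)%:R).
Proof.
move=> ne e.
set x := similarity _ _ in e *.
have x0 m : 0 <= bary m x.
  by rewrite /x bary_similarity mulr_ge0 ?invr_ge0 ?ler0n // addr_ge0 ?ler0n ?bary_word_ge0.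
have xi : 2^-1 <= bary i x.
  by rewrite /x bary_similarity eqxx mulrDr mulr1 lerDr mulr_ge0 ?invr_ge0 ?ler0n ?bary_word_ge0.
have xj : 2^-1 <= bary j x.
  by rewrite e bary_similarity eqxx mulrDr mulr1 lerDr mulr_ge0 ?invr_ge0 ?ler0n ?bary_word_ge0.
have s := sum_bary x.
have ji : j != i by rewrite eq_sym.
rewrite (bigD1 i) // (bigD1 j) //= in s.
have r0 (m : 'I_3) : (m != i) && (m != j) ->
   bary m x <= \sum_(m < 3 | (m != i) && (m != j)) bary m x.
  by move=> mij; rewrite (bigD1 m) //= lerDl sumr_ge0.
have r1 : 0 <= \sum_(m < 3 | (m != i) && (m != j)) bary m x by apply: sumr_ge0.
move=> m; have [<-|im] := eqVneq i m.
  by rewrite (negbTE ji) /= mulr0n mulr1n; lra.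
rewrite mulr0n; have [<-|jm] := eqVneq j m; first by rewrite mulr1n; lra.
rewrite mulr0n.
have := r0 m; rewrite eq_sym im eq_sym jm => /(_ isT) h.
by have := x0 m; lra.
Qed.

(** If the words first differed at some letter,
both corners would have the same barycentric coordinates there, which the
corners of one cell do not. *)
Lemma edge_inj w w' i j i' j' : size w = size w' -> i != j ->
  word_map K w (q i) = word_map K w' (q i') ->
  word_map K w (q j) = word_map K w' (q j') ->
  [/\ w = w', i = i' & j = j'].
Proof.
elim: w w' => [|a w IH] [|a' w'] //=.
  by move=> _ _ /vertex_inj -> /vertex_inj ->.
move=> [sw] ij ei ej; have [aa'|aa'] := eqVneq a a'.
  rewrite -aa' in ei ej *.
  by have [-> -> ->] := IH _ sw ij (similarity_inj ei) (similarity_inj ej).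
have hi := corner_bary_half aa' ei; have hj := corner_bary_half aa' ej.
have e m : bary m (word_map K w (q i)) = bary m (word_map K w (q j)).
  by have := hi m; have := hj m; rewrite !bary_similarity; lra.
case/eqP: ij; elim: w e {IH sw ei ej hi hj} => [|b w IH] /= e.
  have := e i; rewrite !bary_vertex eqxx; case: eqVneq => [->//|_] /eqP.
  by rewrite oner_eq0.
by apply: IH => m; have := e m; rewrite !bary_similarity; lra.
Qed.

Lemma closed_gasket : closed (gasket_set K).
Proof.
apply: compact_closed; last exact: gasket_compact.
exact: (@norm_hausdorff _ 'rV[R]_2).
Qed.

Lemma similarity_gasket i x : gasket_set K x -> gasket_set K (similarity (q i) x).
Proof. by move=> Kx; rewrite gasket_self_similar; exists i => //; exists x. Qed.

Lemma word_gasket w x : gasket_set K x -> gasket_set K (word_map K w x).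
Proof. by move=> Kx; elim: w => //= i w; apply: similarity_gasket. Qed.

Lemma cvg_half_pow : (2^-1 : R) ^+ n @[n --> \oo] --> (0 : R).
Proof. by apply: cvg_expr; rewrite ger0_norm ?invr_ge0 // invf_lt1 // ltr1n. Qed.

(** Iterating the i-th similarity from any point of the gasket converges to its
fixed point. *)
Lemma vertex_gasket i : gasket_set K (q i).
Proof.
have [x Kx] := gasket_nonempty K.
apply: (@closed_cvg _ _ \oo _ (fun n => word_map K (nseq n i) x) _ closed_gasket).
  by apply: nearW => n; apply: word_gasket.
have -> : (fun n => word_map K (nseq n i) x) =
   (fun n => q i + 2^-1 ^+ n *: (x - q i)).
  apply/funext => n; have := word_mapB (nseq n i) x (q i).
  by rewrite word_map_nseq size_nseq => <-; rewrite addrC subrK.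
rewrite -[X in _ --> X]addr0; apply: cvgD; first exact: cvg_cst.
rewrite -(scale0r (x - q i)); apply: cvgZ; [exact: cvg_half_pow|exact: cvg_cst].
Qed.

Definition corner (w : seq 'I_3) (i : 'I_3) : gpoint K :=
  exist _ (word_map K w (q i)) (mem_set (word_gasket w (vertex_gasket i))).

Lemma corner_val w i : set_val (corner w i) = word_map K w (q i).
Proof. by []. Qed.

Lemma gpoint_inj (x y : gpoint K) : set_val x = set_val y -> x = y.
Proof. exact: val_inj. Qed.

Lemma corner_inj w : injective (corner w).
Proof. by move=> i j /(congr1 (@set_val _ _)) /word_map_inj /vertex_inj. Qed.

Lemma corner_rcons w k : corner (rcons w k) k = corner w k.
Proof. by apply: gpoint_inj; rewrite !corner_val word_map_rcons similarity_center. Qed.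

Lemma corner_rconsC w k l : corner (rcons w k) l = corner (rcons w l) k.
Proof. by apply: gpoint_inj; rewrite !corner_val !word_map_rcons similarityC. Qed.

(** Letters are appended at the end, so that the words of level m+1 list the three
subcells of each cell of level m. *)
Fixpoint words (m : nat) : seq (seq 'I_3) :=
  if m is m.+1 then [seq rcons w k | w <- words m, k <- enum 'I_3] else [:: [::]].

Lemma mem_words m w : (w \in words m) = (size w == m).
Proof.
elim: m w => [|m IH] w /=; first by rewrite inE; case: w.
apply/allpairsP/eqP => [[[v k] /= [vm _ ->]]|].
  by rewrite size_rcons; congr S; apply/eqP; rewrite -IH.
case/lastP: w => // v k; rewrite size_rcons => -[vm].
by exists (v, k); rewrite /= IH vm eqxx mem_enum.
Qed.

Lemma words_uniq m : uniq (words m).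
Proof.
elim: m => //= m IH; apply: allpairs_uniq => //; first exact: enum_uniq.
by move=> [v k] [v' k'] _ _ /= /rcons_inj [-> ->].
Qed.

Lemma big_wordsS (F : seq 'I_3 -> R) m :
  \sum_(w <- words m.+1) F w = \sum_(w <- words m) \sum_(k < 3) F (rcons w k).
Proof.
rewrite /= big_allpairs_dep; apply: eq_bigr => w _.
by rewrite big_enum.
Qed.

Lemma in_cellP w (p : gpoint K) : in_cell w p <-> exists i, p = corner w i.
Proof.
split=> [[i e]|[i ->]]; exists i => //.
exact: gpoint_inj.
Qed.

Lemma finite_vertices m : finite_set (@vertices R K m).
Proof.
apply: (@sub_finite_set _ _ [set` [seq corner w i | w <- words m, i <- enum 'I_3]]);
  last exact: finite_seq.
move=> p [w wm /in_cellP [i ->]] /=; apply/allpairsP; exists (w, i).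
by rewrite mem_words wm eqxx mem_enum.
Qed.

Definition cell_edges (a : gpoint K * gpoint K -> R) (w : seq 'I_3) : R :=
  \sum_(i < 3) \sum_(j < 3 | i != j) a (corner w i, corner w j).

Definition edge_index m : seq (seq 'I_3 * ('I_3 * 'I_3)) :=
  [seq (w, z) | w <- words m, z <- [seq z <- enum predT | z.1 != z.2]].

(** Each ordered pair of neighbours of level m lies in exactly one cell, so the
graph sum runs over cells. *)
Lemma graph_sumE m (a : gpoint K * gpoint K -> R) :
  graph_sum m a = (3 / 5) ^- m * \sum_(w <- words m) cell_edges a w.
Proof.
congr (_ * _).
pose V := @vertices R K m; pose N := @neighbours R K m.
have NV p : N p `<=` V by move=> r [_ [w [wm _ rw]]]; exists w.
(* Extending the inner sum by zero makes both ranges independent. *)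
transitivity (\sum_(p \in V) \sum_(r \in V) (if r \in N p then a (p, r) else 0)).
  apply: eq_fsbigr => p _; rewrite -fsbig_mkcondr; apply: eq_fsbigl.
  by apply/esym/setIidPr/NV.
have finV : finite_set V := @finite_vertices m.
rewrite pair_fsbig //=.
transitivity (\sum_(z \in [set z | N z.1 z.2]) a z).
  apply/esym.
  rewrite (_ : [set z | _] = (V `*` V) `&` [set z | N z.1 z.2]); last first.
    apply/seteqP; split=> [[p r] /= pr|[p r] []//]; split=> //; split => /=.
      by case: pr => _ [w [wm pw _]]; exists w.
    exact: NV pr.
  rewrite fsbig_mkcondr; apply: eq_fsbigr => -[p r] _ /=.
  by congr (if _ then _ else _); apply/idP/idP; rewrite !inE.
pose h (z : seq 'I_3 * ('I_3 * 'I_3)) := (corner z.1 z.2.1, corner z.1 z.2.2).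
have memE z : (z \in edge_index m) = (size z.1 == m) && (z.2.1 != z.2.2).
  case: z => w z; apply/allpairsP/idP => [[[v y] /= [vm]]|/= /andP[wm ne]].
    by rewrite mem_filter => /andP[ne _] [-> ->]; rewrite ne -mem_words vm.
  by exists (w, z); rewrite mem_words mem_filter ne mem_enum.
rewrite (@reindex_fsbig _ _ _ _ _ h [set` edge_index m]); last first.
  split.
  - move=> [w [i j]] /=; rewrite memE /= => /andP[/eqP wm ne]; split => /=.
      by move/corner_inj/eqP; rewrite eq_sym (negbTE ne).
    by exists w; split=> //; [exists i|exists j].
  - move=> [w [i j]] [w' [i' j']]; rewrite !inE /= !memE /=.
    move=> /andP[/eqP wm ne] /andP[/eqP wm' ne'] [e e'].
    by have [-> -> ->] := edge_inj (etrans wm (esym wm')) ne e e'.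
  - move=> [p r] [/= ne [w [wm /in_cellP[i pi] /in_cellP[j rj]]]].
    exists (w, (i, j)); last by rewrite /h /= -pi -rj.
    rewrite /= memE /= wm eqxx /=; apply/eqP => ij.
    by apply: ne; rewrite pi rj ij.
rewrite -fsbig_seq; last first.
  apply: allpairs_uniq; first exact: words_uniq.
    by rewrite filter_uniq // enum_uniq.
  by move=> [v y] [v' y'] _ _ [-> ->].
rewrite /edge_index big_allpairs; apply: eq_bigr => w _.
by rewrite big_filter /= big_enum_cond /= /cell_edges pair_big_dep.
Qed.

End Geometry.

(** * Graph energies and the energy form *)

Section ContinuousFunctions.
Variables (R : realType) (T : topologicalType).
Implicit Types f g : T -> R.

Lemma addfE (U : Type) (f g : U -> R) x : (f + g) x = f x + g x.
Proof. by []. Qed.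

Lemma subfE (U : Type) (f g : U -> R) x : (f - g) x = f x - g x.
Proof. by []. Qed.

Lemma scalefE (U : Type) c (f : U -> R) x : (c *: f) x = c * f x.
Proof. by []. Qed.

Lemma continuous_add f g : continuous f -> continuous g -> continuous (f + g).
Proof. by move=> cf cg x; apply: cvgD; [exact: cf|exact: cg]. Qed.

Lemma continuous_mul f g : continuous f -> continuous g -> continuous (f \* g).
Proof. by move=> cf cg x; apply: cvgM; [exact: cf|exact: cg]. Qed.

Lemma continuous_scale c f : continuous f -> continuous (c *: f).
Proof. exact: (@continuous_mul (fun=> c) f (fun=> cvg_cst _)). Qed.

End ContinuousFunctions.

Section Energy.
Variables (R : realType) (K : gasket R).
Local Notation X := (gpoint K).
Implicit Types (f g : X -> R) (a b : X * X -> R).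

Lemma scale_gt0 m : 0 < (3 / 5 : R) ^- m.
Proof. by rewrite invr_gt0 exprn_gt0 // divr_gt0. Qed.

Lemma graph_sumD m a b : graph_sum m (a \+ b) = graph_sum m a + graph_sum m b.
Proof.
rewrite !graph_sumE -mulrDr -big_split; congr (_ * _); apply: eq_bigr => w _.
rewrite /cell_edges -big_split; apply: eq_bigr => i _.
by rewrite -big_split.
Qed.

Lemma graph_sumZ m c a : graph_sum m (c \*o a) = c * graph_sum m a.
Proof.
rewrite !graph_sumE mulrCA; congr (_ * _); rewrite mulr_sumr; apply: eq_bigr => w _.
rewrite /cell_edges mulr_sumr; apply: eq_bigr => i _.
by rewrite mulr_sumr.
Qed.

Lemma le_graph_sum m a b : (forall z, a z <= b z) -> graph_sum m a <= graph_sum m b.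
Proof.
move=> ab; rewrite !graph_sumE ler_pM2l ?scale_gt0 //.
by apply: ler_sum => w _; apply: ler_sum => i _; apply: ler_sum.
Qed.

Lemma graph_sum_ge0 m a : (forall z, 0 <= a z) -> 0 <= graph_sum m a.
Proof.
move=> a0; rewrite graph_sumE; apply: mulr_ge0; first exact: ltW (scale_gt0 m).
by apply: sumr_ge0 => w _; apply: sumr_ge0 => i _; apply: sumr_ge0.
Qed.

Lemma edge_le_graph_sum w i j a : (forall z, 0 <= a z) -> i != j ->
  a (corner K w i, corner K w j) <= (3 / 5) ^+ size w * graph_sum (size w) a.
Proof.
move=> a0 ij; rewrite graph_sumE mulrA divff ?mul1r; last first.
  by rewrite expf_eq0 negb_and orbC mulf_neq0.
have wm : w \in words (size w) by rewrite mem_words.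
rewrite (big_rem w) //= -[leLHS]addr0 lerD //; last first.
  by apply: sumr_ge0 => v _; apply: sumr_ge0 => k _; apply: sumr_ge0.
rewrite /cell_edges (bigD1 i) //= (bigD1 j) //= -addrA lerDl addr_ge0 //.
  exact: sumr_ge0.
by apply: sumr_ge0 => k _; apply: sumr_ge0.
Qed.

Lemma cvg_graph_sum m (A : nat -> X * X -> R) a :
  (forall z, A n z @[n --> \oo] --> a z) ->
  graph_sum m (A n) @[n --> \oo] --> graph_sum m a.
Proof.
move=> Aa; rewrite graph_sumE; under eq_fun do rewrite graph_sumE.
apply: cvgM; first exact: cvg_cst.
rewrite /cell_edges.
apply: cvg_big => [|w _]; first exact: add_continuous.
apply: cvg_big => [|i _]; first exact: add_continuous.
by apply: cvg_big => [|j _]; first exact: add_continuous.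
Qed.

Definition sqdiff f : X * X -> R := fun z => (f z.1 - f z.2) ^+ 2.

Definition level_energy m f : R := graph_sum m (sqdiff f).

Lemma du_sqr f : du f \* du f = sqdiff f.
Proof. by apply/funext. Qed.

Lemma level_energy_ge0 m f : 0 <= level_energy m f.
Proof. by apply: graph_sum_ge0 => z; apply: sqr_ge0. Qed.

Lemma big_ord3 (F : 'I_3 -> R) :
  \sum_(i < 3) F i = F ord0 + F (inord 1) + F ord_max.
Proof.
rewrite !big_ord_recl big_ord0 addr0 addrA; congr (_ + F _ + F _);
  by apply: val_inj; rewrite /= ?inordK.
Qed.

Lemma big_ord3_ne (F : 'I_3 -> 'I_3 -> R) :
  \sum_(i < 3) \sum_(j < 3 | i != j) F i j =
  F ord0 (inord 1) + F ord0 ord_max + (F (inord 1) ord0 + F (inord 1) ord_max)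
  + (F ord_max ord0 + F ord_max (inord 1)).
Proof.
under eq_bigr do rewrite big_mkcond big_ord3.
by rewrite big_ord3 /= -!val_eqE /= !inordK //= !addr0 !add0r.
Qed.

(** The values at the midpoints that minimise the energy of the refined triangle
are the weighted means (2 x_k + 2 x_l + x_m) / 5; the remainder is a positive
quadratic form in the deviations from them. *)
Lemma refine_triangle (x : 'I_3 -> R) (y : 'I_3 -> 'I_3 -> R) :
  (forall k, y k k = x k) -> (forall k l, y k l = y l k) ->
  \sum_(i < 3) \sum_(j < 3 | i != j) (x i - x j) ^+ 2 <=
  5 / 3 * \sum_(k < 3) \sum_(i < 3) \sum_(j < 3 | i != j) (y k i - y k j) ^+ 2.
Proof.
move=> yx yC; rewrite [X in _ * X]big_ord3 !(big_ord3_ne (fun i j => (_ i - _ j) ^+ 2)) !yx.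
rewrite (yC (inord 1) ord0) (yC ord_max ord0) (yC ord_max (inord 1)).
set x0 := x ord0; set x1 := x (inord 1); set x2 := x ord_max.
set y01 := y ord0 (inord 1); set y02 := y ord0 ord_max.
set y12 := y (inord 1) ord_max.
pose d01 := y01 - (2 * x0 + 2 * x1 + x2) / 5.
pose d02 := y02 - (2 * x0 + 2 * x2 + x1) / 5.
pose d12 := y12 - (2 * x1 + 2 * x2 + x0) / 5.
rewrite -subr_ge0 (_ : _ - _ = 10 / 3 * ((d01 - d02) ^+ 2 + (d01 - d12) ^+ 2
  + (d02 - d12) ^+ 2 + 2 * (d01 ^+ 2 + d02 ^+ 2 + d12 ^+ 2))); last first.
  by rewrite /d01 /d02 /d12; field.
by rewrite mulr_ge0 ?divr_ge0 // !addr_ge0 ?sqr_ge0 // mulr_ge0 // !addr_ge0 ?sqr_ge0.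
Qed.

Lemma level_energyS m f : level_energy m f <= level_energy m.+1 f.
Proof.
rewrite /level_energy !graph_sumE big_wordsS exprS invfM -mulrA mulrCA.
rewrite ler_pM2l ?scale_gt0 // invf_div mulr_sumr; apply: ler_sum => w _.
apply: (@refine_triangle (fun i => f (corner K w i))
  (fun k l => f (corner K (rcons w k) l))) => [k|k l]; first by rewrite corner_rcons.
by rewrite corner_rconsC.
Qed.

Lemma nondecreasing_level_energy f : nondecreasing_seq (level_energy^~ f).
Proof. by apply/nondecreasing_seqP => m; apply: level_energyS. Qed.

Lemma EdomP f :
  Edom f <-> continuous f /\ exists M, forall m, level_energy m f <= M.
Proof.
have nd : nondecreasing_seq (fun m => (level_energy m f)%:E).
  by move=> m n mn; rewrite lee_fin nondecreasing_level_energy.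
have e : energy f = ereal_sup (range (fun m => (level_energy m f)%:E)).
  exact/cvg_lim/ereal_nondecreasing_cvgn.
rewrite /Edom e; split=> -[cf].
  move=> lt; split=> //.
  have ub m : ((level_energy m f)%:E <= ereal_sup (range (fun m => (level_energy m f)%:E)))%E.
    by apply: ereal_sup_ubound; exists m.
  exists (fine (ereal_sup (range (fun m => (level_energy m f)%:E)))) => m.
  rewrite -lee_fin fineK // ge0_fin_numE //.
  by apply: le_trans (ub 0%N); rewrite lee_fin level_energy_ge0.
move=> [M fM]; split=> //; apply: (@le_lt_trans _ _ M%:E); last exact: ltry.
by apply: ge_ereal_sup => _ [m _ <-]; rewrite lee_fin.
Qed.

Lemma Edom_continuous f : Edom f -> continuous f.
Proof. by case. Qed.

Lemma cvg_level_energy f : Edom f -> level_energy m f @[m --> \oo] --> energy_form f f.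
Proof.
move=> /EdomP[_ [M fM]].
have : cvgn (level_energy^~ f).
  apply: (nondecreasing_is_cvgn (nondecreasing_level_energy f)).
  by exists M => _ [m _ <-].
by rewrite /energy_form /field_form du_sqr.
Qed.

Lemma level_energy_le f m : Edom f -> level_energy m f <= energy_form f f.
Proof.
move=> fE; have c := cvg_level_energy fE; rewrite -(cvg_lim _ c) //.
apply: nondecreasing_cvgn_le; [exact: nondecreasing_level_energy|exact: cvgP c].
Qed.

Lemma energy_form_le f M : Edom f -> (forall m, level_energy m f <= M) ->
  energy_form f f <= M.
Proof.
move=> fE fM; have c := cvg_level_energy fE; rewrite -(cvg_lim _ c) //.
by apply: limr_le; [exact: cvgP c|apply: nearW].
Qed.

Lemma energy_form_ge0 f : Edom f -> 0 <= energy_form f f.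
Proof. by move=> fE; apply: le_trans (level_energy_le 0 fE); apply: level_energy_ge0. Qed.

(** All closure properties of the form domain, and all bounds on energies of
composite functions, come from this comparison of increments. *)
Lemma energy_dominated (F : X -> R) f g (a b : R) : continuous F -> Edom f -> Edom g ->
  0 <= a -> 0 <= b ->
  (forall x y, (F x - F y) ^+ 2 <= a * (f x - f y) ^+ 2 + b * (g x - g y) ^+ 2) ->
  Edom F /\ energy_form F F <= a * energy_form f f + b * energy_form g g.
Proof.
move=> cF fE gE a0 b0 Ffg.
have le m : level_energy m F <= a * energy_form f f + b * energy_form g g.
  apply: (@le_trans _ _ (graph_sum m ((a \*o sqdiff f) \+ (b \*o sqdiff g)))).
    by apply: le_graph_sum => z; apply: Ffg.
  rewrite graph_sumD !graph_sumZ lerD // ler_wpM2l //; exact: level_energy_le.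
have FE : Edom F by apply/EdomP; split=> //; eexists; apply: le.
by split=> //; apply: energy_form_le.
Qed.

Lemma Edom_cst (c : R) : Edom ((fun=> c) : X -> R).
Proof.
apply/EdomP; split; first exact: cst_continuous.
exists 0 => m; rewrite /level_energy (_ : sqdiff _ = (0 : R) \*o sqdiff ((fun=> c) : X -> R)).
  by rewrite graph_sumZ mul0r.
by apply/funext => z; rewrite /sqdiff /= subrr expr0n mul0r.
Qed.

Lemma EdomD f g : Edom f -> Edom g -> Edom (f + g).
Proof.
move=> fE gE; apply: (proj1 (@energy_dominated (f + g) f g 2 2 _ fE gE _ _ _)).
- by apply: continuous_add; apply: Edom_continuous.
- by [].
- by [].
- move=> x y; rewrite !addfE -subr_ge0.
  set u := f x; set v := f y; set s := g x; set t := g y.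
  by rewrite (_ : _ - _ = (u - v - (s - t)) ^+ 2) ?sqr_ge0 //; ring.
Qed.

Lemma EdomZ c f : Edom f -> Edom (c *: f).
Proof.
move=> fE; apply: (proj1 (@energy_dominated (c *: f) f f (c ^+ 2) 0 _ fE fE _ _ _)).
- by apply: continuous_scale; apply: Edom_continuous.
- exact: sqr_ge0.
- by [].
- by move=> x y; rewrite !scalefE mul0r addr0 -exprMn mulrBr.
Qed.

Lemma EdomB f g : Edom f -> Edom g -> Edom (f - g).
Proof. by move=> fE gE; apply: EdomD => //; rewrite -scaleN1r; apply: EdomZ. Qed.

(** Polarisation reduces the convergence of the mixed sums to that of energies. *)
Lemma cvg_energy_form f g : Edom f -> Edom g ->
  graph_sum m (du f \* du g) @[m --> \oo] --> energy_form f g.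
Proof.
move=> fE gE.
have e : (fun m => graph_sum m (du f \* du g)) =
         (fun m => 4^-1 * (level_energy m (f + g) - level_energy m (f - g))).
  apply/funext => m.
  rewrite (_ : du f \* du g =
    4^-1 \*o (sqdiff (f + g) \+ ((-1) \*o sqdiff (f - g)))); last first.
    apply/funext => z; rewrite /du /sqdiff /= !subfE !addfE.
    by field.
  by rewrite graph_sumZ graph_sumD graph_sumZ mulN1r.
have : cvgn (fun m => graph_sum m (du f \* du g)).
  rewrite e; apply: is_cvgM; first exact: is_cvg_cst.
  apply: is_cvgB; apply: cvgP; apply: cvg_level_energy.
    exact: EdomD.
  exact: EdomB.
by [].
Qed.

Lemma energy_formC f g : energy_form f g = energy_form g f.
Proof.
rewrite /energy_form /field_form; congr (limn _); apply/funext => m.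
by congr graph_sum; apply/funext => z /=; rewrite mulrC.
Qed.

Lemma energy_form_linear c f g h : Edom f -> Edom g -> Edom h ->
  energy_form (c *: f + g) h = c * energy_form f h + energy_form g h.
Proof.
move=> fE gE hE.
have fgE : Edom (c *: f + g) by apply: EdomD => //; apply: EdomZ.
rewrite {1}/energy_form /field_form; apply/cvg_lim => //.
rewrite (_ : (fun m => graph_sum m (du (c *: f + g) \* du h)) =
  (fun m => c * graph_sum m (du f \* du h) + graph_sum m (du g \* du h))).
  apply: cvgD; last exact: cvg_energy_form.
  by apply: cvgM; [exact: cvg_cst|exact: cvg_energy_form].
apply/funext => m; rewrite -graph_sumZ -graph_sumD; congr graph_sum.
apply/funext => z; rewrite /du /=.
by rewrite !addfE !scalefE; ring.
Qed.

Lemma energy_formZl c f h : Edom f -> Edom h ->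
  energy_form (c *: f) h = c * energy_form f h.
Proof.
move=> fE hE; have := energy_form_linear (c - 1) fE fE hE.
by rewrite scalerBl scale1r subrK => ->; ring.
Qed.

Lemma energy_form_mono_ge0 f g : Edom f -> Edom g ->
  (forall x y, 0 <= (f x - f y) * (g x - g y)) -> 0 <= energy_form f g.
Proof.
move=> fE gE fg; have c := cvg_energy_form fE gE; rewrite -(cvg_lim _ c) //.
apply: limr_ge; first exact: cvgP c.
by apply: nearW => m; apply: graph_sum_ge0 => z; apply: fg.
Qed.

End Energy.

(** * Oscillation on cells *)

Lemma continuous_affine (R : realType) (V : normedModType R) (c : R) (b : V) :
  continuous (fun y : V => c *: y + b).
Proof.
move=> x; apply: cvgD; last exact: cvg_cst.
by apply: cvgZ; [exact: cvg_cst|exact: cvg_id].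
Qed.

Section Oscillation.
Variables (R : realType) (K : gasket R).
Local Notation X := (gpoint K).
Implicit Types (f g : X -> R).

(** The oscillation along an edge shrinks by the square root of 3/5 from one level
to the next. *)
Definition osc_rate : R := Num.sqrt (3 / 5).

(** The sum of the geometric series of ratio [osc_rate]. *)
Definition osc_const : R := (1 - osc_rate)^-1.

Lemma osc_rate_ge0 : 0 <= osc_rate.
Proof. exact: sqrtr_ge0. Qed.

Lemma osc_rate_lt1 : osc_rate < 1.
Proof. by rewrite -[ltRHS]sqrtr1 ltr_sqrt //; lra. Qed.

Lemma osc_const_gt0 : 0 < osc_const.
Proof. by rewrite invr_gt0 subr_gt0 osc_rate_lt1. Qed.

Lemma osc_constE : 1 + osc_rate * osc_const = osc_const.
Proof.
have h : 1 - osc_rate != 0 by rewrite subr_eq0 gt_eqF // osc_rate_lt1.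
by rewrite /osc_const; field.
Qed.

Lemma edge_osc f w i j : Edom f ->
  `|f (corner K w i) - f (corner K w j)| <=
  osc_rate ^+ size w * Num.sqrt (energy_form f f).
Proof.
move=> fE; have [->|ij] := eqVneq i j.
  by rewrite subrr normr0 mulr_ge0 ?exprn_ge0 ?osc_rate_ge0 ?sqrtr_ge0.
rewrite -sqrtr_sqr -(ger0_norm (exprn_ge0 (size w) osc_rate_ge0)) -sqrtr_sqr.
rewrite -sqrtrM ?sqr_ge0 // ler_sqrt; last first.
  by rewrite mulr_ge0 ?sqr_ge0 ?energy_form_ge0.
rewrite exprAC sqr_sqrtr //.
have sq0 z : 0 <= sqdiff f z by apply: sqr_ge0.
apply: le_trans (edge_le_graph_sum w sq0 ij) _.
by rewrite ler_wpM2l ?exprn_ge0 // level_energy_le.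
Qed.

(** Refining a cell changes the value at a corner by at most the edge
oscillation of each level, and these form a geometric series. *)
Lemma chain_osc f w w' i j : Edom f ->
  `|f (corner K (w ++ w') i) - f (corner K w j)| <=
  osc_const * osc_rate ^+ size w * Num.sqrt (energy_form f f).
Proof.
move=> fE; elim: w' w j => [|k w' IH] w j.
  rewrite cats0; apply: le_trans (edge_osc w i j fE) _.
  rewrite ler_wpM2r ?sqrtr_ge0 // -[leLHS]mul1r ler_wpM2r ?exprn_ge0 ?osc_rate_ge0 //.
  by rewrite -osc_constE lerDl mulr_ge0 ?osc_rate_ge0 // ltW // osc_const_gt0.
rewrite -cat_rcons -(subrK (f (corner K (rcons w k) k)) (f _)) -addrA.
apply: le_trans (ler_normD _ _) _.
rewrite [leLHS]addrC -{1}osc_constE mulrDl mul1r mulrDl.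
apply: lerD; first by rewrite corner_rcons edge_osc.
by apply: le_trans (IH (rcons w k) k) _; rewrite size_rcons exprS mulrA (mulrC osc_rate).
Qed.

Definition cell (w : seq 'I_3) : set X :=
  [set p | exists2 y, gasket_set K y & set_val p = word_map K w y].

Lemma gasket_words n y : gasket_set K y ->
  exists2 w, size w = n & exists2 z, gasket_set K z & y = word_map K w z.
Proof.
elim: n y => [|n IH] y Ky; first by exists [::] => //; exists y.
move: (Ky); rewrite {1}gasket_self_similar => -[i _ [y' Ky' <-]].
by have [w <- [z Kz ->]] := IH _ Ky'; exists (i :: w) => //; exists z.
Qed.

Lemma cell_cover n (p : X) : exists2 w, size w = n & cell w p.
Proof. by have [w wn [z Kz pz]] := gasket_words n (set_valP p); exists w => //; exists z. Qed.

Lemma nbhs_gpoint (p : X) (U : set X) : nbhs p U ->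
  exists2 d : R, 0 < d & forall s, `|set_val p - set_val s| < d -> U s.
Proof.
move=> [B [[V oV <-] /= Vp BU]].
have : nbhs (set_val p) V by apply: open_nbhs_nbhs; split.
move=> /(@nbhs_ballP R 'rV[R]_2) [d d0 dV].
by exists d => // s ps; apply: BU; apply: dV; rewrite -ball_normE.
Qed.

Lemma gasket_bounded : exists M : R, forall x y,
  gasket_set K x -> gasket_set K y -> `|x - y| <= M.
Proof.
have /compact_bounded [M [_ KM]] := @gasket_compact _ K.
exists (M + 1 + (M + 1)) => x y Kx Ky; apply: le_trans (ler_normB _ _) _.
by apply: lerD; apply: KM => //; rewrite ltrDl.
Qed.

(** Corners of ever smaller subcells converge to p, where f is continuous. *)
Lemma cell_osc_corner f w j p : Edom f -> cell w p ->
  `|f p - f (corner K w j)| <=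
  osc_const * osc_rate ^+ size w * Num.sqrt (energy_form f f).
Proof.
move=> fE [y Ky py]; apply/ler_addgt0Pr => e e0.
have : \forall s \near p, `|f p - f s| < e.
  by have /cvgrPdist_lt := @Edom_continuous _ _ _ fE p; apply.
move=> /nbhs_gpoint [d d0 dp].
have [M KM] := gasket_bounded.
have M0 : 0 <= M by apply: le_trans (KM _ _ Ky Ky); apply: normr_ge0.
have : \forall n \near \oo, (2^-1 : R) ^+ n * (M + 1) < d.
  have : (2^-1 : R) ^+ n * (M + 1) @[n --> \oo] --> 0.
    by rewrite -(mul0r (M + 1)); apply: cvgM; [exact: cvg_half_pow|exact: cvg_cst].
  by move/cvgrPdist_lt/(_ d d0); apply: filterS => n; rewrite sub0r normrN => /ltr_normlW.
move=> [n _ /(_ n (leqnn n)) /= nd].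
have [w' w'n [z Kz yz]] := gasket_words n Ky.
have /dp fp : `|set_val p - set_val (corner K (w ++ w') ord0)| < d.
  rewrite py yz -word_map_cat corner_val word_mapB normrZ size_cat w'n.
  rewrite ger0_norm ?exprn_ge0 ?invr_ge0 //; apply: le_lt_trans nd.
  rewrite exprD -mulrA -[leRHS]mul1r ler_pM ?exprn_ge0 ?mulr_ge0 ?invr_ge0 //.
    by rewrite exprn_ile1 ?invr_ge0 // invf_le1 // ler1n.
  rewrite ler_wpM2l ?exprn_ge0 ?invr_ge0 //.
  by apply: le_trans (KM _ _ Kz (vertex_gasket K ord0)) _; rewrite lerDl.
rewrite -(subrK (f (corner K (w ++ w') ord0)) (f p)) -addrA.
apply: le_trans (ler_normD _ _) _; rewrite [leLHS]addrC.
by apply: lerD; [exact: chain_osc|exact: ltW].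
Qed.

Lemma cell_osc f w p s : Edom f -> cell w p -> cell w s ->
  `|f p - f s| <= 2 * osc_const * osc_rate ^+ size w * Num.sqrt (energy_form f f).
Proof.
move=> fE wp ws; rewrite -(subrK (f (corner K w ord0)) (f p)) -addrA.
apply: le_trans (ler_normD _ _) _; rewrite -!mulrA mulr_natl mulr2n !mulrA.
by apply: lerD; [|rewrite distrC]; apply: cell_osc_corner.
Qed.

Lemma energy_osc f x y : Edom f ->
  `|f x - f y| <= 2 * osc_const * Num.sqrt (energy_form f f).
Proof.
move=> fE; have c p : cell [::] p by exists (set_val p) => //; apply: set_valP.
by have := cell_osc fE (c x) (c y); rewrite /= expr0 mulr1.
Qed.

Lemma closed_cell w : closed (cell w).
Proof.
rewrite (_ : cell w = set_val @^-1` (word_map K w @` gasket_set K)); last first.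
  by apply/seteqP; split=> p [y Ky py]; exists y.
apply: closed_comp.
  by move=> x _; apply: initial_continuous.
apply: compact_closed; first exact: (@norm_hausdorff _ 'rV[R]_2).
apply: continuous_compact; last exact: gasket_compact.
apply: continuous_subspaceT => x.
rewrite (_ : word_map K w = fun y => 2^-1 ^+ size w *: y + word_map K w 0).
  exact: (@continuous_affine R 'rV[R]_2).
by apply/funext => y; have := word_mapB K w y 0; rewrite subr0 => <-; rewrite subrK.
Qed.

(** Finitely many closed cells can be avoided at once. *)
Lemma separating_nbhs (s : seq (seq 'I_3)) (x : X) :
  exists2 U : set X, open U /\ U x &
    forall w, w \in s -> ~ cell w x -> forall y, U y -> ~ cell w y.
Proof.
elim: s => [|v s [U [oU Ux] Us]]; first by exists setT => //; split=> //; apply: openT.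
have [vx|vx] := pselect (cell v x).
  exists U => // w; rewrite in_cons => /orP[/eqP ->//|]; exact: Us.
exists (U `&` ~` cell v).
  by split=> //; apply: openI => //; rewrite openC; apply: closed_cell.
move=> w; rewrite in_cons => /orP[/eqP -> _ y []//|ws wx y [Uy _]].
exact: Us wx y Uy.
Qed.

(** Near x, all cells of level m that do not contain x can be avoided, so every
point there shares a cell with x; the bound on the oscillation in that cell
depends only on the energy. *)
Lemma energy_equicontinuous (x : X) (M e : R) : 0 < e ->
  exists2 U : set X, open U /\ U x & forall f y,
    Edom f -> energy_form f f <= M -> U y -> `|f x - f y| <= e.
Proof.
move=> e0; pose B := 2 * osc_const * Num.sqrt M.
have : osc_rate ^+ n * B @[n --> \oo] --> 0.
  rewrite -(mul0r B); apply: cvgM; last exact: cvg_cst.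
  by apply: cvg_expr; rewrite ger0_norm ?osc_rate_ge0 // osc_rate_lt1.
move=> /cvgrPdist_lt /(_ e e0) [n _ /(_ n (leqnn n))] /=.
rewrite sub0r normrN => /ltr_normlW ne.
have [U [oU Ux] Us] := separating_nbhs (words n) x.
exists U => // f y fE fM Uy; apply: le_trans (ltW ne).
have [w wn wy] := cell_cover n y.
have wx : cell w x.
  by apply: contrapT => wx; apply: (Us w) wx y Uy wy; rewrite mem_words wn.
apply: le_trans (cell_osc fE wx wy) _.
rewrite wn /B mulrA (mulrC (osc_rate ^+ n)) ler_wpM2l //.
  by rewrite !mulr_ge0 ?exprn_ge0 ?osc_rate_ge0 // ltW // osc_const_gt0.
by rewrite ler_wsqrtr.
Qed.

End Oscillation.

(** * The space of square integrable functions *)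

Section L2.
Variables (R : realType) (K : gasket R).
Variable mu : {finite_measure set (borel K) -> \bar R}.
Local Notation X := (gpoint K).
Implicit Types (f g h : X -> R).
Local Notation "''N' f" := (Num.sqrt (L2ip mu f f)) (at level 10, f at level 8).
Local Notation aeq f g := ((f : borel K -> R) = g %[ae mu]).

Lemma le12 : (1 <= 2%:E :> \bar R)%E.
Proof. by rewrite lee_fin ler1n. Qed.

Lemma L2_measurable f : L2 mu f -> measurable_fun setT (f : borel K -> R).
Proof. by rewrite /L2 inE => /andP[]; rewrite inE. Qed.

Lemma L2_mul_integrable f g : L2 mu f -> L2 mu g ->
  mu.-integrable setT (EFin \o ((fun x => f x * g x) : borel K -> R)).
Proof. by move=> fL gL; apply/Lfun1_integrable; apply: Lfun2_mul_Lfun1. Qed.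

Lemma L2_linear c f g : L2 mu f -> L2 mu g -> L2 mu (c *: f + g).
Proof. by move=> fL gL; have [_ h] := Lfun_submod_closed mu le12; apply: h. Qed.

Lemma L2_0 : L2 mu 0.
Proof. by have [h _] := Lfun_submod_closed mu le12; apply: h. Qed.

Lemma L2Z c f : L2 mu f -> L2 mu (c *: f).
Proof. by move=> fL; rewrite -[_ *: _]addr0; apply: L2_linear => //; apply: L2_0. Qed.

Lemma L2D f g : L2 mu f -> L2 mu g -> L2 mu (f + g).
Proof. by move=> fL gL; rewrite -[f]scale1r; apply: L2_linear. Qed.

Lemma L2B f g : L2 mu f -> L2 mu g -> L2 mu (f - g).
Proof. by move=> fL gL; rewrite addrC -scaleN1r; apply: L2_linear. Qed.

Lemma L2ipC f g : L2ip mu f g = L2ip mu g f.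
Proof. by apply: eq_Rintegral => x _; rewrite mulrC. Qed.

Lemma L2ip_linear c f g h : L2 mu f -> L2 mu g -> L2 mu h ->
  L2ip mu (c *: f + g) h = c * L2ip mu f h + L2ip mu g h.
Proof.
move=> fL gL hL; rewrite /L2ip -RintegralZl //; last exact: L2_mul_integrable.
rewrite -RintegralD //; last exact: L2_mul_integrable.
  by apply: eq_Rintegral => x _; rewrite addfE scalefE mulrDl mulrA.
have := L2_mul_integrable (L2Z c fL) hL.
by congr (integrable _ _ _); apply/funext => x /=; rewrite scalefE mulrA.
Qed.

Lemma L2ipZl c f h : L2 mu f -> L2 mu h -> L2ip mu (c *: f) h = c * L2ip mu f h.
Proof.
move=> fL hL; rewrite -[c *: f]addr0 L2ip_linear //; last exact: L2_0.
have := L2ip_linear (-1) L2_0 L2_0 hL; rewrite scaler0 addr0.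
by rewrite mulN1r addNr => ->; rewrite addr0.
Qed.

Lemma L2ipDl f g h : L2 mu f -> L2 mu g -> L2 mu h ->
  L2ip mu (f + g) h = L2ip mu f h + L2ip mu g h.
Proof. by move=> fL gL hL; rewrite -{1}[f]scale1r L2ip_linear // mul1r. Qed.

Lemma L2ipBl f g h : L2 mu f -> L2 mu g -> L2 mu h ->
  L2ip mu (f - g) h = L2ip mu f h - L2ip mu g h.
Proof.
by move=> fL gL hL; rewrite addrC -scaleN1r L2ip_linear // mulN1r addrC.
Qed.

Lemma L2ip_ge0 f : 0 <= L2ip mu f f.
Proof. by apply: Rintegral_ge0 => x _; rewrite -expr2 sqr_ge0. Qed.

Lemma L2ip_add_sqr f g : L2 mu f -> L2 mu g ->
  L2ip mu (f + g) (f + g) = L2ip mu f f + 2 * L2ip mu f g + L2ip mu g g.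
Proof.
move=> fL gL; have sL := L2D fL gL.
rewrite L2ipDl // (L2ipC f) (L2ipC g) !L2ipDl // (L2ipC g f); ring.
Qed.

Lemma L2norm_sqr f : ('N f) ^+ 2 = L2ip mu f f.
Proof. by rewrite sqr_sqrtr // L2ip_ge0. Qed.

Lemma cauchy_schwarz f g : L2 mu f -> L2 mu g -> `|L2ip mu f g| <= 'N f * 'N g.
Proof.
move=> fL gL; rewrite -sqrtrM ?L2ip_ge0 // -sqrtr_sqr ler_sqrt; last first.
  by rewrite mulr_ge0 ?L2ip_ge0.
set A := L2ip mu f f; set B := L2ip mu f g; set C := L2ip mu g g.
have q s : 0 <= s ^+ 2 * A + 2 * s * B + C.
  have := L2ip_ge0 (s *: f + g); rewrite L2ip_add_sqr //; last exact: L2Z.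
  rewrite (L2ipZl s fL gL) (L2ipZl s fL (L2Z s fL)) (L2ipC f) (L2ipZl s fL fL).
  by rewrite -/A -/B -/C !mulrA expr2.
have A0 : 0 <= A := L2ip_ge0 f.
have [A00|A1] := eqVneq A 0.
  rewrite A00 mul0r; have [->|B1] := eqVneq B 0; first by rewrite expr0n.
  (* The quadratic is then affine in s and would take the value -1. *)
  have := q (- (C + 1) / (2 * B)); rewrite A00 mulr0 add0r.
  by rewrite (_ : 2 * _ * B = - (C + 1)); [lra|field].
have := q (- B / A); rewrite (_ : _ + _ = (A * C - B ^+ 2) / A); last by field.
by rewrite pmulr_lge0 ?subr_ge0 // invr_gt0 lt_def A1.
Qed.

Lemma L2norm_triangle f g : L2 mu f -> L2 mu g -> 'N (f + g) <= 'N f + 'N g.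
Proof.
move=> fL gL; rewrite -(@ler_pXn2r _ 2) ?nnegrE ?addr_ge0 ?sqrtr_ge0 //.
rewrite sqrrD !L2norm_sqr L2ip_add_sqr // lerD2r lerD2l.
have := le_trans (ler_norm _) (cauchy_schwarz fL gL).
by rewrite mulr2n; lra.
Qed.

Lemma L2normZ c f : L2 mu f -> 'N (c *: f) = `|c| * 'N f.
Proof.
move=> fL; rewrite (L2ipZl c fL (L2Z c fL)) L2ipC (L2ipZl c fL fL) mulrA -expr2.
by rewrite sqrtrM ?sqr_ge0 // sqrtr_sqr.
Qed.

Lemma L2normE f : L2 mu f -> L2norm mu f = ('N f)%:E.
Proof.
move=> fL; rewrite /L2norm unlock.
have e : (\int[mu]_x (f x * f x)%:E = (L2ip mu f f)%:E)%E.
  rewrite /L2ip /Rintegral fineK //; apply: integrable_fin_num => //.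
  exact: L2_mul_integrable.
rewrite (_ : (\int[mu]_x _)%E = (L2ip mu f f)%:E); last first.
  rewrite -e; apply: eq_integral => x _ /=.
  by rewrite powR_mulrn // real_normK ?num_real // expr2.
by rewrite poweR_EFin powR12_sqrt // L2ip_ge0.
Qed.

Lemma L2ip_aeq f f' g : L2 mu f -> L2 mu f' -> L2 mu g ->
  aeq f f' -> L2ip mu f g = L2ip mu f' g.
Proof.
move=> fL fL' gL ff'; rewrite /L2ip /Rintegral; congr fine.
apply: ae_eq_integral => //.
- by case/integrableP: (L2_mul_integrable fL gL).
- by case/integrableP: (L2_mul_integrable fL' gL).
- by apply: filterS ff' => x e _ /=; rewrite e.
Qed.

Lemma L2norm_aeq f f' : L2 mu f -> L2 mu f' -> aeq f f' -> 'N f = 'N f'.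
Proof.
move=> fL fL' ff'; rewrite (L2ip_aeq fL fL' fL ff') L2ipC.
by rewrite (L2ip_aeq fL fL' fL' ff').
Qed.

Lemma open_measurable_gpoint (U : set X) : open U -> measurable (U : set (borel K)).
Proof. by move=> oU; apply: sub_sigma_algebra. Qed.

Lemma continuous_measurable_gpoint f : continuous f ->
  measurable_fun setT (f : borel K -> R).
Proof.
move=> cf; apply: (measurability _ (RGenOpens.measurableE R)).
move=> _ [_ [a [b ->]] <-]; rewrite setTI; apply: open_measurable_gpoint.
by apply: open_comp => [x _|]; [exact: cf|exact: interval_open].
Qed.

Lemma L2_dominated f g : L2 mu f -> measurable_fun setT (g : borel K -> R) ->
  (forall x, `|g x| <= `|f x|) -> L2 mu g.
Proof.
move=> fL mg gf; have mf := L2_measurable fL.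
rewrite /L2 inE; apply/andP; rewrite !inE; split=> //=.
rewrite /finite_norm unlock; apply: poweR_lty.
apply: (@le_lt_trans _ _ (\int[mu]_x ((f x) * f x)%:E)%E); last first.
  by apply: integrable_lty => //; exact: L2_mul_integrable.
have -> : (\int[mu]_x (`|(EFin \o g) x| `^ 2) = \int[mu]_x ((g x) ^+ 2)%:E)%E.
  apply: eq_integral => x _ /=.
  by rewrite powR_mulrn // real_normK ?num_real.
apply: ge0_le_integral => //=.
- by move=> x _; rewrite lee_fin sqr_ge0.
- by apply/measurable_EFinP; apply: measurable_funX.
- by apply/measurable_EFinP; apply: measurable_funM.
- by move=> x _; rewrite lee_fin -expr2 -ler_sqrt ?sqr_ge0 // !sqrtr_sqr.
Qed.

Lemma L2_cst (c : R) : L2 mu (fun=> c).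
Proof. exact: Lfun_cst. Qed.

Lemma bounded_L2 f (M : R) : measurable_fun setT (f : borel K -> R) ->
  (forall x, `|f x| <= M) -> L2 mu f.
Proof.
move=> mf fM; apply: L2_dominated (L2_cst M) mf _ => x.
by apply: le_trans (fM x) _; apply: ler_norm.
Qed.

End L2.

(** * Continuous functions and measures of full support *)

Section FullSupport.
Variables (R : realType) (K : gasket R).
Variable mu : {finite_measure set (borel K) -> \bar R}.
Hypothesis mu_full : full_support mu.
Local Notation X := (gpoint K).
Implicit Types (f g h : X -> R).
Local Notation "''N' f" := (Num.sqrt (L2ip mu f f)) (at level 10, f at level 8).

Lemma Edom_bounded f : Edom f -> exists M : R, forall x, `|f x| <= M.
Proof.
move=> fE; exists (`|f point| + 2 * osc_const R * Num.sqrt (energy_form f f)) => x.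
rewrite -{1}(subrK (f point) (f x)) addrC; apply: le_trans (ler_normD _ _) _.
by rewrite lerD2l; apply: energy_osc.
Qed.

Lemma Edom_L2 f : Edom f -> L2 mu f.
Proof.
move=> fE; have [M fM] := Edom_bounded fE.
exact: bounded_L2 (continuous_measurable_gpoint (Edom_continuous fE)) fM.
Qed.

(** Otherwise U would have positive measure. *)
Lemma open_ae_empty (U : set X) : open U ->
  (\forall x \ae mu, (~` U) (x : borel K)) -> U = set0.
Proof.
move=> oU ae; apply/eqP; apply: contrapT => /negP /set0P U0.
have := mu_full oU U0; rewrite (_ : mu U = 0%E) ?ltxx //.
apply: measure_negligible; first exact: open_measurable_gpoint.
move: ae; apply: negligibleS => x Ux; exact.
Qed.

Lemma continuous_ae_le f g : continuous f -> continuous g ->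
  (\forall x \ae mu, f (x : borel K) <= g x) -> forall x, f x <= g x.
Proof.
move=> cf cg fg.
have o : open [set x | 0 < (f - g) x].
  apply: (@open_comp _ _ (f - g) [set r : R | 0 < r]); last exact: open_gt.
  move=> x _; apply: continuous_add => //; rewrite -scaleN1r.
  exact: continuous_scale.
have e : [set x | 0 < (f - g) x] = set0.
  apply: open_ae_empty => //; apply: filterS fg => x /= fgx.
  by rewrite subfE subr_gt0 ltNge fgx.
move=> x; rewrite leNgt; apply/negP => gf.
by have : (set0 : set X) x by rewrite -e /= subr_gt0.
Qed.

Lemma continuous_ae_eq f g : continuous f -> continuous g ->
  ((f : borel K -> R) = g %[ae mu]) -> f = g.
Proof.
move=> cf cg fg; apply/funext => x; apply/eqP; rewrite eq_le; apply/andP; split.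
  by apply: continuous_ae_le x => //; apply: filterS fg => y /(_ I) ->.
by apply: continuous_ae_le x => //; apply: filterS fg => y /(_ I) ->.
Qed.

Lemma mu_open_gt0 (U : set X) : open U -> U !=set0 -> 0 < fine (mu U).
Proof.
move=> oU U0; apply: fine_gt0; rewrite mu_full //=.
by rewrite -ge0_fin_numE // fin_num_measure //; apply: open_measurable_gpoint.
Qed.

Lemma L2ip_ge_open f (U : set X) (e : R) : L2 mu f -> open U -> 0 <= e ->
  (forall x, U x -> e <= `|f x|) -> e ^+ 2 * fine (mu U) <= L2ip mu f f.
Proof.
move=> fL oU e0 ef; have mU := open_measurable_gpoint oU.
have fi := L2_mul_integrable fL fL.
rewrite -(Rintegral_cst mu mU (e ^+ 2)).
apply: (@le_trans _ _ (\int[mu]_(x in (U : set (borel K))) (f x * f x))).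
  apply: le_Rintegral => //.
  - exact: finite_measure_integrable_cst.
  - by apply: integrableS fi.
  - move=> x Ux; rewrite -expr2 -ler_sqrt ?sqr_ge0 // !sqrtr_sqr ger0_norm //.
    exact: ef.
rewrite /L2ip [leRHS](_ : _ = fine (\int[mu]_x (f x * f x)%:E)%E) //.
apply: fine_le.
- by apply: integrable_fin_num => //; apply: integrableS fi.
- exact: integrable_fin_num.
- apply: ge0_subset_integral => //=.
    by case/integrableP: fi.
  by move=> x _; rewrite lee_fin -expr2 sqr_ge0.
Qed.

(** The oscillation is controlled by the energy, and a function that is large
everywhere has a large L2 norm. *)
Lemma sup_le_form_norm f x : Edom f ->
  `|f x| <= 2 * osc_const R * Num.sqrt (energy_form f f)
            + 'N f / Num.sqrt (fine (mu setT)).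
Proof.
move=> fE; set B := 2 * _ * _; have fL := Edom_L2 fE.
have m0 : 0 < fine (mu setT) by apply: mu_open_gt0; [exact: openT|exists x].
have [fB|Bf] := lerP `|f x| B.
  by apply: le_trans fB _; rewrite lerDl divr_ge0 ?sqrtr_ge0.
rewrite -lerBlDl ler_pdivlMr ?sqrtr_gt0 //.
rewrite -[X in X * _]ger0_norm ?subr_ge0 ?(ltW Bf) // -sqrtr_sqr -sqrtrM ?sqr_ge0 //.
rewrite ler_wsqrtr //; apply: L2ip_ge_open => //; first exact: openT.
  by rewrite subr_ge0 ltW.
move=> y _; rewrite lerBlDl.
apply: le_trans (lerD (energy_osc x y fE) (lexx `|f y|)).
by rewrite -{1}(subrK (f y) (f x)) ler_normD.
Qed.

(** L2 convergence of a sequence of bounded energy is pointwise: by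
equicontinuity, a deviation at x persists on a neighbourhood of x, which has
positive measure. *)
Lemma bounded_energy_cvg_pointwise (v : nat -> X -> R) w (M : R) :
  (forall n, Edom (v n)) -> (forall n, energy_form (v n) (v n) <= M) -> Edom w ->
  'N (v n - w) @[n --> \oo] --> 0 ->
  forall x, v n x @[n --> \oo] --> w x.
Proof.
move=> vE vM wE vw x; apply/cvgrPdist_le => e e0.
have e4 : 0 < e / 4 by rewrite divr_gt0.
have [U [oU Ux] UM] := energy_equicontinuous x (Num.max M (energy_form w w)) e4.
have m0 : 0 < fine (mu U) by apply: mu_open_gt0 => //; exists x.
pose d := (e / 2) * Num.sqrt (fine (mu U)).
have d0 : 0 < d by rewrite mulr_gt0 ?divr_gt0 ?sqrtr_gt0.
move/cvgrPdist_lt: vw => /(_ d d0); apply: filterS => n.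
rewrite sub0r normrN => /ltr_normlW Nd; rewrite leNgt; apply/negP => evw.
suff : d <= 'N (v n - w) by rewrite leNgt Nd.
rewrite /d -[X in X * _]ger0_norm ?divr_ge0 ?(ltW e0) // -sqrtr_sqr.
rewrite -sqrtrM ?sqr_ge0 // ler_wsqrtr //.
have vwE := EdomB (vE n) wE.
apply: L2ip_ge_open => //; [exact: Edom_L2|by rewrite divr_ge0 ?(ltW e0)|].
move=> y Uy.
have h1 : `|v n x - v n y| <= e / 4 by apply: UM => //; rewrite le_max vM.
have h2 : `|w x - w y| <= e / 4 by apply: UM => //; rewrite le_max lexx orbT.
have : `|w x - v n x| <= `|w x - w y| + `|(v n - w) y| + `|v n x - v n y|.
  have -> : w x - v n x = (w x - w y) - (v n y - w y) - (v n x - v n y) by ring.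
  apply: le_trans (ler_normB _ _) _; rewrite lerD2r.
  exact: ler_normB.
lra.
Qed.

Lemma cvg_level_energy_pointwise (v : nat -> X -> R) w m :
  (forall x, v n x @[n --> \oo] --> w x) ->
  level_energy m (v n) @[n --> \oo] --> level_energy m w.
Proof.
by move=> vw; apply: cvg_graph_sum => z; apply: cvgM; apply: cvgB; exact: vw.
Qed.

Lemma energy_lsc (v : nat -> X -> R) w (M : R) :
  (forall n, Edom (v n)) -> (forall n, energy_form (v n) (v n) <= M) -> continuous w ->
  (forall x, v n x @[n --> \oo] --> w x) ->
  forall m, level_energy m w <= M.
Proof.
move=> vE vM cw vw m.
have c : level_energy m (v n) @[n --> \oo] --> level_energy m w.
  exact: cvg_level_energy_pointwise.
rewrite -(cvg_lim _ c) //; apply: limr_le; first exact: cvgP c.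
by apply: nearW => n; apply: le_trans (level_energy_le m (vE n)) (vM n).
Qed.

End FullSupport.

(** * Closedness of the form and approximation by the domain of the generator *)

Lemma continuous_by_open (R : realType) (T : topologicalType) (w : T -> R) :
  (forall x e, 0 < e -> exists2 U : set T, open U /\ U x &
    forall y, U y -> `|w x - w y| <= e) -> continuous w.
Proof.
move=> wU x; apply/cvgrPdist_le => e e0; have [U [oU Ux] Ue] := wU x e e0.
have nU : nbhs x U by apply: open_nbhs_nbhs; split.
by apply: filterS nU => y; apply: Ue.
Qed.

Section Minimiser.
Variables (R : realType) (K : gasket R).
Variable mu : {finite_measure set (borel K) -> \bar R}.
Hypothesis mu_full : full_support mu.
Local Notation X := (gpoint K).
Implicit Types (f g h u v : X -> R).
Local Notation "''N' f" := (Num.sqrt (L2ip mu f f)) (at level 10, f at level 8).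
Local Notation En f := (energy_form f f).

Lemma energy_add_scale s u v : Edom u -> Edom v ->
  En (s *: v + u) = En u + 2 * s * energy_form u v + s ^+ 2 * En v.
Proof.
move=> uE vE; have wE : Edom (s *: v + u) by apply: EdomD => //; apply: EdomZ.
rewrite energy_form_linear // (energy_formC v) (energy_formC u).
rewrite (energy_form_linear s vE uE vE) (energy_form_linear s vE uE uE).
rewrite (energy_formC v u); ring.
Qed.

Lemma L2_add_scale s u v : L2 mu u -> L2 mu v ->
  L2ip mu (s *: v + u) (s *: v + u) =
  L2ip mu u u + 2 * s * L2ip mu u v + s ^+ 2 * L2ip mu v v.
Proof.
move=> uE vE; have wE : L2 mu (s *: v + u) by apply: L2_linear.
rewrite L2ip_linear // (L2ipC mu v) (L2ipC mu u).
rewrite (L2ip_linear s vE uE vE) (L2ip_linear s vE uE uE).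
rewrite (L2ipC mu v u); ring.
Qed.

Lemma L2norm_le_sup f (c : R) : measurable_fun setT (f : borel K -> R) ->
  (forall x, `|f x| <= c) -> 'N f <= c * Num.sqrt (fine (mu setT)).
Proof.
move=> mf fc; have fL := bounded_L2 mu mf fc.
have c0 : 0 <= c := le_trans (normr_ge0 _) (fc point).
rewrite -[X in X * _]ger0_norm // -sqrtr_sqr -sqrtrM ?sqr_ge0 // ler_wsqrtr //.
rewrite -(Rintegral_cst mu measurableT (c ^+ 2)); apply: le_Rintegral => //.
- exact: L2_mul_integrable.
- exact: finite_measure_integrable_cst.
- move=> x _; rewrite -expr2 -ler_sqrt ?sqr_ge0 // !sqrtr_sqr (ger0_norm c0).
  exact: fc.
Qed.

(** The form is closed: equicontinuity makes a uniform limit of functions of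
bounded energy continuous, and lower semicontinuity bounds its energy. *)
Lemma form_complete (u : nat -> X -> R) (c : nat -> R) (M : R) :
  (forall n, Edom (u n)) -> (forall n, En (u n) <= M) ->
  (forall n k x, (n <= k)%N -> `|u n x - u k x| <= c n) -> c n @[n --> \oo] --> 0 ->
  exists w, [/\ Edom w, forall x, u n x @[n --> \oo] --> w x
    & 'N (u n - w) @[n --> \oo] --> 0].
Proof.
move=> uE uM uc c0.
have cvgu x : cvgn (fun n => u n x).
  apply: cauchy_cvg; apply: cauchy_exP => e e0.
  move/cvgrPdist_lt: c0 => /(_ e e0) [N _ /(_ N (leqnn N))] /=.
  rewrite sub0r normrN => /ltr_normlW cN; exists (u N x); exists N => // k Nk.
  by rewrite /= -ball_normE /=; apply: le_lt_trans (uc N k x Nk) cN.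
pose w x := limn (fun n => u n x).
have uw x : u n x @[n --> \oo] --> w x by exact: cvgu.
have unw n x : `|u n x - w x| <= c n.
  have h : `|u n x - u k x| @[k --> \oo] --> `|u n x - w x|.
    by apply: cvg_norm; apply: cvgB; [exact: cvg_cst|exact: uw].
  rewrite -(cvg_lim _ h) //; apply: limr_le; first exact: cvgP h.
  by exists n => // k; apply: uc.
have cw : continuous w.
  apply: continuous_by_open => x e e0.
  have [U oU UM] := energy_equicontinuous x M e0.
  exists U => // y Uy.
  have h : `|u n x - u n y| @[n --> \oo] --> `|w x - w y|.
    by apply: cvg_norm; apply: cvgB; exact: uw.
  rewrite -(cvg_lim _ h) //; apply: limr_le; first exact: cvgP h.
  by apply: nearW => n; apply: UM.
have wE : Edom w.
  by apply/EdomP; split=> //; exists M; apply: energy_lsc uE uM cw uw.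
exists w; split=> //.
have Nc n : 'N (u n - w) <= c n * Num.sqrt (fine (mu setT)).
  apply: L2norm_le_sup; last exact: unw.
  by apply: continuous_measurable_gpoint; apply: Edom_continuous; apply: EdomB.
apply: (@squeeze_cvgr _ _ _ _ (fun=> 0) (fun n => c n * Num.sqrt (fine (mu setT)))).
- by apply: nearW => n; rewrite sqrtr_ge0 Nc.
- exact: cvg_cst.
- by rewrite -(mul0r (Num.sqrt (fine (mu setT)))); apply: cvgM => //; exact: cvg_cst.
Qed.

Lemma L2norm_le_dist u v f : L2 mu u -> L2 mu v -> L2 mu f ->
  'N (u - f) <= 'N (v - f) + 'N (u - v).
Proof.
move=> uL vL fL; rewrite (_ : u - f = (v - f) + (u - v)).
  by apply: L2norm_triangle; apply: L2B.
by rewrite [RHS]addrC addrA subrK.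
Qed.

Lemma L2normB f g : L2 mu f -> L2 mu g -> 'N (f - g) <= 'N f + 'N g.
Proof.
move=> fL gL; have := L2norm_triangle fL (L2Z (-1) gL).
by rewrite (L2normZ _ gL) normrN1 mul1r scaleN1r.
Qed.

Lemma L2norm_distC u v : L2 mu u -> L2 mu v -> 'N (u - v) = 'N (v - u).
Proof.
move=> uL vL; rewrite -(opprB v u) -scaleN1r L2normZ; last exact: L2B.
by rewrite normrN1 mul1r.
Qed.

Lemma cvg_L2norm_dist (u : nat -> X -> R) w f :
  (forall n, L2 mu (u n)) -> L2 mu w -> L2 mu f ->
  'N (u n - w) @[n --> \oo] --> 0 -> 'N (u n - f) @[n --> \oo] --> 'N (w - f).
Proof.
move=> uL wL fL uw.
apply: (@squeeze_cvgr _ _ _ _ (fun n => 'N (w - f) - 'N (u n - w))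
                              (fun n => 'N (w - f) + 'N (u n - w))).
- apply: nearW => n; rewrite lerBlDr L2norm_le_dist // andbT.
  by rewrite (L2norm_distC (uL n) wL) L2norm_le_dist.
- by rewrite -[X in _ --> X]subr0; apply: cvgB => //; exact: cvg_cst.
- by rewrite -[X in _ --> X]addr0; apply: cvgD => //; exact: cvg_cst.
Qed.


Section Resolvent.
Variables (f : X -> R) (lam : R).
Hypotheses (fE : Edom f) (lam0 : 0 < lam).

(** The minimiser of this functional is lam / (lam - L) f, a resolvent of f. *)
Definition penalised u : R := En u + lam * L2ip mu (u - f) (u - f).

Lemma penalised_ge0 u : Edom u -> 0 <= penalised u.
Proof. by move=> uE; rewrite addr_ge0 ?energy_form_ge0 // mulr_ge0 ?L2ip_ge0 // ltW. Qed.

(** The parallelogram identity, which makes minimising sequences Cauchy. *)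
Lemma penalised_midpoint u v : Edom u -> Edom v ->
  En (v - u) + lam * L2ip mu (v - u) (v - u) =
  2 * penalised u + 2 * penalised v - 4 * penalised (2^-1 *: (v - u) + u).
Proof.
move=> uE vE; rewrite /penalised.
have dE : Edom (v - u) by apply: EdomB.
have ufL : L2 mu (u - f) by apply: Edom_L2; apply: EdomB.
have dL : L2 mu (v - u) by apply: Edom_L2.
rewrite (_ : 2^-1 *: (v - u) + u - f = 2^-1 *: (v - u) + (u - f)); last by rewrite addrA.
have e1 := energy_add_scale 1 uE dE; rewrite scale1r subrK in e1.
have e2 := L2_add_scale 1 ufL dL; rewrite scale1r addrA subrK in e2.
rewrite e1 e2 energy_add_scale // L2_add_scale //; by field.
Qed.

Lemma penalised_min : exists2 u, Edom u & forall v, Edom v -> penalised u <= penalised v.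
Proof.
pose S := [set penalised u | u in @Edom R K].
have S0 : has_inf S.
  split; first by exists (penalised f), f.
  by exists 0 => _ [u uE <-]; apply: penalised_ge0.
have Sle u : Edom u -> inf S <= penalised u.
  by move=> uE; apply: ge_inf; [exact: (proj2 S0)|exists u].
(* With excess 4^-n, the uniform distances decrease like 2^-n. *)
have hn n : (0 : R) < (2^-1 ^+ n) ^+ 2 by rewrite !exprn_gt0 ?invr_gt0.
have /choice [u uP] n : exists u, Edom u /\ penalised u <= inf S + (2^-1 ^+ n) ^+ 2.
  have [_ [u uE <-] lt] := inf_adherent (hn n) S0.
  by exists u; split=> //; apply: ltW.
have uE n := proj1 (uP n); have uI n := proj2 (uP n).
have half1 n : (2^-1 ^+ n : R) <= 1.
  by rewrite exprn_ile1 ?invr_ge0 // invf_le1 // ler1n.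
have uM n : En (u n) <= inf S + 1.
  apply: le_trans (lerD (lexx (inf S)) (_ : (2^-1 ^+ n) ^+ 2 <= 1)).
    by apply: le_trans (uI n); rewrite lerDl mulr_ge0 ?L2ip_ge0 // ltW.
  by rewrite exprn_ile1 // exprn_ge0 // invr_ge0.
pose A := 2 * osc_const R + (Num.sqrt lam * Num.sqrt (fine (mu setT)))^-1.
have uc n k x : (n <= k)%N -> `|u n x - u k x| <= A * (2 * 2^-1 ^+ n).
  move=> nk.
  have D := penalised_midpoint (uE k) (uE n).
  have mE : Edom (2^-1 *: (u n - u k) + u k).
    by apply: EdomD => //; apply: EdomZ; apply: EdomB.
  have dE := EdomB (uE n) (uE k).
  have hk : (2^-1 ^+ k : R) <= 2^-1 ^+ n.
    by rewrite -(subnK nk) exprD ler_piMl ?exprn_ge0 ?invr_ge0.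
  have hk2 : ((2^-1 ^+ k) ^+ 2 : R) <= (2^-1 ^+ n) ^+ 2.
    by rewrite lerXn2r ?nnegrE ?exprn_ge0 ?invr_ge0.
  have Dle : En (u n - u k) + lam * L2ip mu (u n - u k) (u n - u k) <=
     (2 * 2^-1 ^+ n) ^+ 2.
    by rewrite D exprMn; have := uI n; have := uI k; have := Sle _ mE; lra.
  have h0 : (0 : R) <= 2 * 2^-1 ^+ n by rewrite mulr_ge0 // exprn_ge0 // invr_ge0.
  apply: le_trans (sup_le_form_norm mu_full x dE) _.
  rewrite [leRHS]mulrDl; apply: lerD.
    rewrite ler_wpM2l ?mulr_ge0 ?(ltW (osc_const_gt0 R)) //.
    rewrite -[leRHS]ger0_norm // -sqrtr_sqr ler_wsqrtr //.
    by apply: le_trans Dle; rewrite lerDl mulr_ge0 ?L2ip_ge0 // ltW.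
  rewrite invfM mulrAC ler_wpM2r ?invr_ge0 ?sqrtr_ge0 // ler_pdivlMl ?sqrtr_gt0 //.
  rewrite -(sqrtrM _ (ltW lam0)) -[leRHS]ger0_norm // -sqrtr_sqr ler_wsqrtr //.
  by apply: le_trans Dle; rewrite lerDr energy_form_ge0.
have c0 : A * (2 * 2^-1 ^+ n) @[n --> \oo] --> 0.
  rewrite -(mulr0 A) -[X in A * X](mulr0 2).
  by apply: cvgM; [exact: cvg_cst|apply: cvgM; [exact: cvg_cst|exact: cvg_half_pow]].
have [w [wE uw uwN]] := form_complete uE uM uc c0.
exists w => // v vE; apply: le_trans (Sle v vE).
have fL := Edom_L2 mu fE; have uL n := Edom_L2 mu (uE n); have wL := Edom_L2 mu wE.
have cN := cvg_L2norm_dist uL wL fL uwN.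
rewrite /penalised -lerBrDr; apply: energy_form_le => // m.
rewrite lerBrDr.
have c : level_energy m (u n) + lam * ('N (u n - f)) ^+ 2 - (2^-1 ^+ n) ^+ 2 @[n --> \oo]
   --> level_energy m w + lam * ('N (w - f)) ^+ 2 - 0 ^+ 2.
  apply: cvgB; last by apply: cvgM; exact: cvg_half_pow.
  apply: cvgD; first exact: cvg_level_energy_pointwise.
  by apply: cvgM; [exact: cvg_cst|apply: cvgM].
rewrite -L2norm_sqr -[leLHS]subr0 -[X in _ - X](expr0n _ 2) -(cvg_lim _ c) //.
apply: limr_le; first exact: cvgP c.
apply: nearW => n; rewrite lerBlDr L2norm_sqr; apply: le_trans (uI n).
by rewrite lerD2r level_energy_le.
Qed.

Lemma penalised_euler u : Edom u -> (forall v, Edom v -> penalised u <= penalised v) ->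
  forall phi, Edom phi -> energy_form u phi = - L2ip mu (lam *: (u - f)) phi.
Proof.
move=> uE umin phi pE.
have fL := Edom_L2 mu fE; have uL := Edom_L2 mu uE; have pL := Edom_L2 mu pE.
have ufL := L2B uL fL; rewrite L2ipZl //.
pose a := En phi + lam * L2ip mu phi phi.
pose b := energy_form u phi + lam * L2ip mu (u - f) phi.
have a0 : 0 <= a by rewrite addr_ge0 ?energy_form_ge0 // mulr_ge0 ?L2ip_ge0 // ltW.
have q s : 0 <= 2 * s * b + s ^+ 2 * a.
  have vE : Edom (s *: phi + u) by apply: EdomD => //; apply: EdomZ.
  have := umin _ vE; rewrite /penalised energy_add_scale //.
  rewrite (_ : s *: phi + u - f = s *: phi + (u - f)); last by rewrite addrA.
  rewrite L2_add_scale //.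
  by rewrite /a /b; lra.
have : b = 0.
  apply/eqP; apply: contrapT => /negP bn0.
  have a1 : a + 1 != 0 by rewrite gt_eqF // ltr_wpDl.
  (* The minimum would be at - b / a; the shift by 1 allows a = 0. *)
  have := q (- b / (a + 1)).
  rewrite (_ : _ + _ = - (b ^+ 2 * (a + 2)) / (a + 1) ^+ 2); last by field.
  rewrite pmulr_lge0 ?invr_gt0 ?exprn_gt0 ?ltr_wpDl // oppr_ge0 leNgt.
  by rewrite mulr_gt0 ?ltr_wpDl // lt_def sqr_ge0 sqrf_eq0 bn0.
by rewrite /b; lra.
Qed.

End Resolvent.

(** The minimiser of the energy penalised by the distance to f lies in the domain
of the generator by its Euler equation. Comparing it with f itself bounds both
its energy and its distance to f, which is small for a large penalty. *)
Lemma generator_approx f (e : R) : Edom f -> 0 < e ->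
  exists f' g, [/\ Edom f', L2 mu g, generator mu f' g, En f' <= En f
    & 'N (f - f') <= e].
Proof.
move=> fE e0; have E0 := energy_form_ge0 fE.
pose lam := (En f + 1) / e ^+ 2.
have lam0 : 0 < lam by rewrite divr_gt0 ?exprn_gt0 // ltr_wpDl.
have [u uE umin] := penalised_min fE lam0.
have fL := Edom_L2 mu fE; have uL := Edom_L2 mu uE; have ufL := L2B uL fL.
have gL : L2 mu (lam *: (u - f)) by apply: L2Z.
have le := umin f fE.
have ff0 : L2ip mu (f - f) (f - f) = 0.
  by rewrite subrr -(scale0r f) L2ipZl ?mul0r // scale0r; exact: L2_0.
rewrite /penalised ff0 mulr0 addr0 in le.
have L0 : 0 <= lam * L2ip mu (u - f) (u - f) by rewrite mulr_ge0 ?L2ip_ge0 // ltW.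
exists u, (lam *: (u - f)); split=> //.
- split=> //; exists u; split=> //; first exact: ae_eq_refl.
  exact: penalised_euler.
- by apply: le_trans le; rewrite lerDl.
- rewrite (L2norm_distC fL uL) -(ger0_norm (ltW e0)) -sqrtr_sqr ler_wsqrtr //.
  have : lam * L2ip mu (u - f) (u - f) <= En f.
    by apply: le_trans le; rewrite lerDr energy_form_ge0.
  rewrite -ler_pdivlMl // => h; apply: le_trans h _.
  rewrite /lam invf_div mulrAC ler_pdivrMr ?ltr_wpDl // ler_pM2l ?exprn_gt0 //.
  by rewrite lerDl.
Qed.

End Minimiser.

(** * Deficits below a level *)

(** Cut the interval from 0 to t into n steps of length s: the total increase is at
most B t (eta s), which vanishes as n grows. *)
Lemma nonincreasing_by_steps (R : realType) (phi eta : R -> R) (B : R) : 0 <= B ->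
  (forall e : R, 0 < e -> exists2 d : R, 0 < d & forall s : R, 0 < s -> s < d -> eta s <= e) ->
  (forall t s : R, 0 <= t -> 0 < s -> phi (t + s) <= phi t + B * (s * eta s)) ->
  forall t : R, 0 <= t -> phi t <= phi 0.
Proof.
move=> B0 eta0 step t t0; have [->//|tn0] := eqVneq t 0.
have tp : 0 < t by rewrite lt_def tn0.
apply/ler_addgt0Pr => e e0.
have C0 : 0 < B * t + 1 by rewrite ltr_wpDl // mulr_ge0.
have [d d0 dP] := eta0 (e / (B * t + 1)) (divr_gt0 e0 C0).
pose n := Num.bound (t / d).
have td0 : 0 < t / d by rewrite divr_gt0.
have nt : t / d < n%:R := archi_boundP (ltW td0).
have n0 : 0 < n%:R :> R by apply: lt_trans nt.
pose s := t / n%:R.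
have s0 : 0 < s by rewrite divr_gt0.
have sd : s < d by rewrite ltr_pdivrMr // mulrC -ltr_pdivrMr.
have iter k : phi (k%:R * s) <= phi 0 + k%:R * (B * (s * eta s)).
  elim: k => [|k IH]; first by rewrite !mul0r addr0.
  have := step (k%:R * s) s; rewrite mulr_ge0 ?ler0n ?(ltW s0) // s0 => /(_ isT isT).
  rewrite -natr1 !mulrDl !mul1r; lra.
have := iter n; rewrite (_ : n%:R * s = t); last by rewrite mulrC divfK // gt_eqF.
move/le_trans; apply; rewrite lerD2l.
rewrite (_ : n%:R * _ = B * t * eta s); last first.
  by rewrite /s; field; rewrite gt_eqF.
apply: (@le_trans _ _ (B * t * (e / (B * t + 1)))).
  by rewrite ler_wpM2l ?mulr_ge0 // dP.
rewrite mulrCA -[leRHS]mulr1 ler_wpM2l ?(ltW e0) // ler_pdivrMr // mul1r lerDl //.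
Qed.

Section PositivePart.
Variables (R : realType) (K : gasket R).
Variable mu : {finite_measure set (borel K) -> \bar R}.
Local Notation X := (gpoint K).
Local Notation "''N' f" := (Num.sqrt (L2ip mu f f)) (at level 10, f at level 8).
Implicit Types (f g u v : X -> R).

(** It vanishes exactly when c <= f and, as a Lipschitz function of f, stays in the
form domain: its L2 norm measures how far f is from being bounded below by c. *)
Definition deficit (c : R) f : X -> R := fun x => Num.max (c - f x) 0.

Lemma deficit_ge0 c f x : 0 <= deficit c f x.
Proof. by rewrite /deficit le_max lexx orbT. Qed.

Lemma max_subr0 (c a : R) : Num.max (c - a) 0 = if a <= c then c - a else 0.
Proof.
case: lerP => h; first by rewrite max_l // subr_ge0.
by rewrite max_r // subr_le0 ltW.
Qed.

Lemma deficit_lipschitz c f g x y :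
  `|deficit c f x - deficit c g y| <= `|f x - g y|.
Proof.
rewrite /deficit !max_subr0 real_ler_norml ?num_real //.
have := ler_norm (f x - g y); have := ler_norm (- (f x - g y)); rewrite normrN.
move=> h3 h4; case: (lerP (f x) c) => h1; case: (lerP (g y) c) => h2;
  by apply/andP; split; lra.
Qed.

(** Convexity of the square of (c - a)^+ in a, in tangent line form. *)
Lemma deficit_convex c f g x :
  deficit c g x ^+ 2 - 2 * (deficit c g x * (f x - g x)) <= deficit c f x ^+ 2.
Proof.
rewrite /deficit !max_subr0; set a := f x; set b := g x.
rewrite -subr_ge0; case: (lerP a c) => h1; case: (lerP b c) => h2.
- by rewrite (_ : _ - _ = (a - b) ^+ 2) ?sqr_ge0 //; ring.
- by rewrite (_ : _ - _ = (c - a) ^+ 2) ?sqr_ge0 //; ring.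
- rewrite (_ : _ - _ = (c - b) * ((c - b) + 2 * (a - c))); last by ring.
  by apply: mulr_ge0; lra.
- by rewrite expr0n /= mul0r mulr0 subrr.
Qed.

Lemma continuous_deficit c f : continuous f -> continuous (deficit c f).
Proof.
move=> cf; apply: continuous_by_open => x e e0.
have : nbhs x [set y | `|f x - f y| < e].
  by have /cvgrPdist_lt := cf x; apply.
rewrite nbhsE => -[U [oU Ux] Ue]; exists U => // y Uy.
by apply: le_trans (deficit_lipschitz c f f x y) _; apply: ltW (Ue y Uy).
Qed.

Lemma Edom_deficit c f : Edom f -> Edom (deficit c f).
Proof.
move=> fE; apply: (proj1 (@energy_dominated _ _ (deficit c f) f f 1 0 _ fE fE _ _ _)) => //.
  exact/continuous_deficit/Edom_continuous.
move=> x y; rewrite mul0r addr0 mul1r -ler_sqrt ?sqr_ge0 // !sqrtr_sqr.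
exact: deficit_lipschitz.
Qed.

(** (c - a)^+ is nonincreasing in a, so the increments of f and of its deficit have
opposite signs. *)
Lemma energy_form_deficit_le0 c f : Edom f -> energy_form f (deficit c f) <= 0.
Proof.
move=> fE; have dE := Edom_deficit c fE.
rewrite -oppr_ge0 -mulN1r energy_formC -energy_formZl //.
rewrite energy_formC; apply: energy_form_mono_ge0 => //; first exact: EdomZ.
move=> x y; rewrite !scalefE /deficit !max_subr0.
case: (lerP (f x) c) => h1; case: (lerP (f y) c) => h2.
- by rewrite (_ : _ * _ = (f x - f y) ^+ 2) ?sqr_ge0 //; ring.
- rewrite (_ : _ * _ = (f y - f x) * (c - f x)); last by ring.
  by apply: mulr_ge0; lra.
- rewrite (_ : _ * _ = (f x - f y) * (c - f y)); last by ring.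
  by apply: mulr_ge0; lra.
- by rewrite subrr mulr0.
Qed.

Lemma L2_deficit c f : L2 mu f -> L2 mu (deficit c f).
Proof.
move=> fL; have cfL : L2 mu ((fun=> c) - f) by apply: L2B => //; apply: L2_cst.
apply: L2_dominated cfL _ _.
  apply: measurable_maxr; last exact: measurable_cst.
  exact: (measurable_funB (measurable_cst c) (L2_measurable fL)).
move=> x; rewrite subfE ger0_norm ?deficit_ge0 // /deficit ge_max ler_norm /=.
exact: normr_ge0.
Qed.

Lemma le_L2norm f g : L2 mu f -> L2 mu g -> (forall x, `|f x| <= `|g x|) -> 'N f <= 'N g.
Proof.
move=> fL gL fg; rewrite ler_wsqrtr //; apply: le_Rintegral => //.
- exact: L2_mul_integrable.
- exact: L2_mul_integrable.
- by move=> x _; rewrite -!expr2 -ler_sqrt ?sqr_ge0 // !sqrtr_sqr.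
Qed.

Lemma L2norm_deficit_dist c f g : L2 mu f -> L2 mu g ->
  'N (deficit c f) <= 'N (deficit c g) + 'N (f - g).
Proof.
move=> fL gL; have dfL := L2_deficit c fL; have dgL := L2_deficit c gL.
have := L2norm_triangle dgL (L2B dfL dgL).
rewrite [deficit c g + _]addrC subrK => /le_trans; apply; rewrite lerD2l.
apply: le_L2norm; [exact: L2B|exact: L2B|move=> x].
by rewrite !subfE; apply: deficit_lipschitz.
Qed.

Lemma L2norm_deficit_convex c f g : L2 mu f -> L2 mu g ->
  L2ip mu (deficit c g) (deficit c g) - 2 * L2ip mu (deficit c g) (f - g) <=
  L2ip mu (deficit c f) (deficit c f).
Proof.
move=> fL gL; have dfL := L2_deficit c fL; have dgL := L2_deficit c gL.
have fgL := L2B fL gL.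
have dL : L2 mu (deficit c g - 2 *: (f - g)) by apply: L2B => //; apply: L2Z.
rewrite (L2ipC mu _ (f - g)) -L2ipZl // -L2ipBl //; last exact: L2Z.
apply: le_Rintegral => //.
- exact: L2_mul_integrable.
- exact: L2_mul_integrable.
- move=> x _; rewrite -expr2; apply: le_trans (deficit_convex c f g x).
  by rewrite !subfE scalefE subfE expr2; lra.
Qed.

End PositivePart.

(** * The heat semigroup *)

Section Semigroup.
Variables (R : realType) (K : gasket R).
Variable mu : {finite_measure set (borel K) -> \bar R}.
Hypothesis mu_full : full_support mu.
Local Notation X := (gpoint K).
Local Notation "''N' f" := (Num.sqrt (L2ip mu f f)) (at level 10, f at level 8).
Local Notation En f := (energy_form f f).
Local Notation aeq f g := ((f : borel K -> R) = g %[ae mu]).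
Implicit Types (f g u v : X -> R).
Variable T : R -> (X -> R) -> X -> R.
Hypothesis T_heat : heat_semigroup mu T.

Lemma cvg_L2norm0P (F : R -> X -> R) : (forall t, 0 < t -> L2 mu (F t)) ->
  L2norm mu (F t) @[t --> (0 : R)^'+] --> 0%E <->
  (forall e : R, 0 < e ->
     exists2 d : R, 0 < d & forall t, 0 < t -> t < d -> 'N (F t) <= e).
Proof.
move=> FL; split=> [/fine_cvgP[_ F0] e e0|F0].
  move/cvgrPdist_le: F0 => /(_ e e0); rewrite near_withinE => /nbhs_ballP[d /= d0 dP].
  exists d => // t t0 td; have /dP : ball (0 : R) d t.
    by rewrite -ball_normE /= sub0r normrN gtr0_norm.
  move=> /(_ t0); rewrite sub0r normrN (L2normE (FL t t0)) /=.
  exact: le_trans (ler_norm _).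
apply/fine_cvgP; split.
  rewrite near_withinE; apply: nearW => t t0.
  by rewrite (L2normE (FL t t0)).
apply/cvgrPdist_le => e e0; have [d d0 dP] := F0 e e0.
rewrite near_withinE; apply/nbhs_ballP; exists d => //= t.
rewrite -ball_normE /= sub0r normrN => td t0.
rewrite (L2normE (FL t t0)) /= sub0r normrN ger0_norm ?sqrtr_ge0 //.
by apply: dP => //; rewrite gtr0_norm in td.
Qed.

Lemma heat_norm t f : 0 <= t -> L2 mu f -> 'N (T t f) <= 'N f.
Proof.
move=> t0 fL; have := heat_contraction T_heat t0 fL.
by rewrite !L2normE ?lee_fin //; exact: heat_L2.
Qed.

Lemma heatB t f g : 0 <= t -> L2 mu f -> L2 mu g -> aeq (T t (f - g)) (T t f - T t g).
Proof.
move=> t0 fL gL; have := heat_linear T_heat (-1) t0 gL fL.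
by rewrite !scaleN1r (addrC (- g)) (addrC (- T t g)).
Qed.

Lemma heat_dist t f g : 0 <= t -> L2 mu f -> L2 mu g ->
  'N (T t f - T t g) <= 'N (f - g).
Proof.
move=> t0 fL gL; have fgL := L2B fL gL.
have TfL := heat_L2 T_heat t0 fL; have TgL := heat_L2 T_heat t0 gL.
rewrite -(L2norm_aeq _ _ (heatB t0 fL gL)); first exact: heat_norm.
  exact: heat_L2.
exact: L2B.
Qed.

(** The remainder in the first order expansion along an orbit is the image under
T t of the remainder at time 0, hence bounded uniformly in t. *)
Lemma heat_remainder t s f g : 0 <= t -> 0 < s -> L2 mu f -> L2 mu g ->
  'N (s^-1 *: (T s (T t f) - T t f) - T t g) <= 'N (s^-1 *: (T s f - f) - g).
Proof.
move=> t0 s0 fL gL; have s0' := ltW s0.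
have TL r h : 0 <= r -> L2 mu h -> L2 mu (T r h) := @heat_L2 _ _ _ _ T_heat r h.
have TsL := TL _ _ s0' fL; have TtL := TL _ _ t0 fL; have TgL := TL _ _ t0 gL.
have dL := L2B TsL fL; have dsL := L2Z s^-1 dL; have rL := L2B dsL gL.
have TTL := TL _ _ s0' TtL; have TTL' := TL _ _ t0 TsL.
rewrite -(@L2norm_aeq _ _ _ (T t (s^-1 *: (T s f - f) - g))).
- exact: heat_norm.
- exact: TL.
- by apply: L2B => //; apply: L2Z; apply: L2B.
have e1 := heatB t0 dsL gL.
have e2 := heat_linear T_heat s^-1 t0 dL (L2_0 mu).
have e3 := heatB t0 TsL fL.
have e4 := heatD T_heat s0' t0 fL; have e5 := heatD T_heat t0 s0' fL.
have e6 := heatB t0 fL fL.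
rewrite addr0 in e2; rewrite subrr in e6; rewrite (addrC t s) in e5.
apply: filterS2 (filterI e1 e2) (filterI (filterI e3 e4) (filterI e5 e6)).
move=> x [/(_ I) h1 /(_ I) h2] [[/(_ I) h3 /(_ I) h4] [/(_ I) h5 /(_ I) h6]] _.
move: h1 h2 h3 h4 h5 h6; rewrite !subfE !addfE !scalefE !subfE.
by move=> -> -> -> <- <- ->; rewrite subrr addr0.
Qed.

(** The domain of the generator is invariant, with the generator acting along the
orbit through the flow: the difference quotients at time t are images of those
at time 0. *)
Lemma generator_heat t f g : 0 <= t -> L2 mu f -> generator mu f g ->
  generator mu (T t f) (T t g).
Proof.
move=> t0 fL fg; have gL := proj1 fg.
have TL r h : 0 <= r -> L2 mu h -> L2 mu (T r h) := @heat_L2 _ _ _ _ T_heat r h.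
have TtL := TL _ _ t0 fL; have TgL := TL _ _ t0 gL.
apply/(heat_generator T_heat) => //; apply/cvg_L2norm0P => [s s0|e e0].
  by apply: L2B => //; apply: L2Z; apply: L2B => //; apply: TL => //; apply: ltW.
move: fg => /(heat_generator T_heat fL gL) /cvg_L2norm0P.
case/(_ _ e e0) => [s s0|d d0 dP].
  by apply: L2B => //; apply: L2Z; apply: L2B => //; apply: TL => //; apply: ltW.
exists d => // s s0 sd; apply: le_trans (dP s s0 sd).
exact: heat_remainder.
Qed.

Section Orbit.
Variables f g : X -> R.
Hypotheses (fL : L2 mu f) (fg : generator mu f g).

Let gL : L2 mu g := proj1 fg.

Let TL t h : 0 <= t -> L2 mu h -> L2 mu (T t h) := @heat_L2 _ _ _ _ T_heat t h.

(** The failure of T s f = f + s g, relative to s, together with the variation of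
T g over a step. *)
Definition step_error s : R := 'N (s^-1 *: (T s f - f) - g) + 'N (T s g - g).

Lemma step_error_small (e : R) : 0 < e ->
  exists2 d : R, 0 < d & forall s, 0 < s -> s < d -> step_error s <= e.
Proof.
move=> e0; have e2 : 0 < e / 2 by rewrite divr_gt0.
have L1 s : 0 < s -> L2 mu (T s g - g).
  by move=> s0; apply: L2B => //; apply: TL => //; apply: ltW.
have L3 s : 0 < s -> L2 mu (s^-1 *: (T s f - f) - g).
  by move=> s0; apply: L2B => //; apply: L2Z; apply: L2B => //; apply: TL => //; apply: ltW.
have [d1 d10 h1] := proj1 (cvg_L2norm0P L1) (heat_continuous T_heat gL) _ e2.
have [d2 d20 h2] := proj1 (cvg_L2norm0P L3) (proj2 (heat_generator T_heat fL gL) fg) _ e2.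
exists (Num.min d1 d2); first by rewrite lt_min d10.
move=> s s0; rewrite lt_min => /andP[s1 s2].
by rewrite /step_error; have := h1 s s0 s1; have := h2 s s0 s2; lra.
Qed.

(** Backward Euler step along the orbit, with an error uniform in t. *)
Lemma heat_backward_step t s : 0 <= t -> 0 < s ->
  exists r, [/\ L2 mu r, 'N r <= s * step_error s &
    aeq (T t f - T (t + s) f) (r - s *: T (t + s) g)].
Proof.
move=> t0 s0; have s0' := ltW s0.
pose r0 := s *: (T s g - g) - s *: (s^-1 *: (T s f - f) - g).
have TsL := TL s0' fL; have TsgL := TL s0' gL.
have aL := L2B TsgL gL; have bL : L2 mu (s^-1 *: (T s f - f) - g).
  by apply: L2B => //; apply: L2Z; apply: L2B.
have saL := L2Z s aL; have sbL := L2Z s bL.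
have r0L : L2 mu r0 by apply: L2B.
exists (T t r0); split; first exact: TL.
  apply: le_trans (heat_norm t0 r0L) _; apply: le_trans (L2normB saL sbL) _.
  by rewrite (L2normZ s aL) (L2normZ s bL) ger0_norm // -mulrDr addrC.
have e0 : r0 = s *: T s g - (T s f - f).
  by rewrite /r0 !scalerBr !scalerA mulfV ?gt_eqF // !scale1r; apply/funext => x;
     rewrite !subfE !scalefE; ring.
have sTL := L2Z s TsgL; have dL := L2B TsL fL.
have e1 := heatB t0 sTL dL; rewrite -e0 in e1.
have e2 := heat_linear T_heat s t0 TsgL (L2_0 mu); rewrite addr0 in e2.
have e3 := heatB t0 TsL fL.
have e4 := heatD T_heat t0 s0' fL; have e5 := heatD T_heat t0 s0' gL.
have e6 := heatB t0 fL fL; rewrite subrr in e6.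
apply: filterS2 (filterI e1 e2) (filterI (filterI e3 e4) (filterI e5 e6)).
move=> x [/(_ I) h1 /(_ I) h2] [[/(_ I) h3 /(_ I) h4] [/(_ I) h5 /(_ I) h6]] _.
move: h1 h2 h3 h4 h5 h6; rewrite !subfE !addfE !scalefE.
by move=> -> -> -> -> -> ->; ring.
Qed.

(** The squared L2 norm of the deficit below c is convex, and its derivative along
the orbit is 2 E(v, (c - v)^+) <= 0. *)
Lemma deficit_orbit_le c t : 0 <= t -> 'N (deficit c (T t f)) <= 'N (deficit c f).
Proof.
move=> t0; rewrite -(L2norm_aeq _ _ (_ : aeq (deficit c (T 0 f)) (deficit c f))).
- rewrite ler_wsqrtr //.
  pose phi t := L2ip mu (deficit c (T t f)) (deficit c (T t f)).
  pose B := 2 * ('N (deficit c f) + 'N f + 'N f).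
  have B0 : 0 <= B by rewrite mulr_ge0 // !addr_ge0 // sqrtr_ge0.
  apply: (@nonincreasing_by_steps _ phi step_error B B0 step_error_small) t0.
  move=> {}t s t0 s0; have ts0 : 0 <= t + s by rewrite addr_ge0 // ltW.
  have vL := TL t0 fL; have vL' := TL ts0 fL; have gL' := TL ts0 gL.
  have pL := L2_deficit c vL'.
  have [r [rL Nr /= rE]] := heat_backward_step t0 s0.
  have := L2norm_deficit_convex c vL vL'; rewrite -/(phi t) -/(phi (t + s)).
  have sgL := L2Z s gL'.
  rewrite (L2ipC mu (deficit _ _) (_ - _)) (L2ip_aeq (L2B vL vL') (L2B rL sgL) pL rE).
  rewrite L2ipBl // L2ipZl //.
  have [_ [v [vE vae vgen]]] := generator_heat ts0 fL fg.
  have pE := Edom_deficit c vE.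
  have h0 : 0 <= L2ip mu (T (t + s) g) (deficit c (T (t + s) f)).
    rewrite L2ipC (@L2ip_aeq _ _ _ _ (deficit c v)) //; last 2 first.
    - exact: Edom_L2.
    - by apply: filterS vae => x h _; rewrite /deficit (h I).
    by rewrite L2ipC -oppr_le0 -vgen // energy_form_deficit_le0.
  have h1 : L2ip mu r (deficit c (T (t + s) f)) <= s * step_error s * ('N (deficit c f) + 'N f + 'N f).
    apply: le_trans (ler_norm _) _; apply: le_trans (cauchy_schwarz rL pL) _.
    apply: ler_pM; rewrite ?sqrtr_ge0 //.
    apply: le_trans (L2norm_deficit_dist c vL' fL) _; rewrite -addrA lerD2l.
    by apply: le_trans (L2normB vL' fL) _; rewrite lerD2r heat_norm.
  have h2 : 0 <= s * L2ip mu (T (t + s) g) (deficit c (T (t + s) f)).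
    by rewrite mulr_ge0 // ltW.
  by rewrite /B; lra.
- exact/L2_deficit/TL.
- exact: L2_deficit.
- by apply: filterS (heat0 T_heat fL) => x h _; rewrite /deficit (h I).
Qed.

(** Along the orbit, the derivative of the energy is -2 |T t g|^2. *)
Lemma energy_orbit_le t w : Edom f -> 0 <= t -> Edom w -> aeq w (T t f) -> En w <= En f.
Proof.
move=> fE t0 wE wae.
have /choice [F FP] r : exists v, 0 <= r -> [/\ Edom v, aeq (T r f) v &
    forall phi, Edom phi -> energy_form v phi = - L2ip mu (T r g) phi].
  have [r0|r0] := lerP 0 r; last by exists 0.
  by have [_ [v [vE vae vgen]]] := generator_heat r0 fL fg; exists v.
have [F0E F0ae _] := FP 0 (lexx _).
have F0f : F 0 = f.
  apply: (continuous_ae_eq mu_full); try exact: Edom_continuous.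
  by apply: filterS2 F0ae (heat0 T_heat fL) => x h1 h2 _; rewrite -(h1 I) (h2 I).
have [FtE Ftae _] := FP t t0.
have Ftw : F t = w.
  apply: (continuous_ae_eq mu_full); try exact: Edom_continuous.
  by apply: filterS2 Ftae wae => x h1 h2 _; rewrite -(h1 I) (h2 I).
suff : En (F t) <= En (F 0) by rewrite Ftw F0f.
have B0 : 0 <= 2 * 'N g by rewrite mulr_ge0 // sqrtr_ge0.
apply: (@nonincreasing_by_steps _ (fun r => En (F r)) step_error _ B0 step_error_small) t0.
move=> {FtE Ftae Ftw wae}t s t0 s0; have ts0 : 0 <= t + s by rewrite addr_ge0 // ltW.
have [FE Fae Fgen] := FP t t0; have [FE' Fae' Fgen'] := FP _ ts0.
have vL := TL t0 fL; have vL' := TL ts0 fL; have gL' := TL ts0 gL.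
have sgL := L2Z s gL'.
have [r [rL Nr rE]] := heat_backward_step t0 s0.
have dE := EdomB FE FE'.
have := energy_form_ge0 dE.
have -> : En (F t - F (t + s)) =
   En (F t) - En (F (t + s)) - 2 * energy_form (F (t + s)) (F t - F (t + s)).
  by have := energy_add_scale 1 FE' dE; rewrite scale1r subrK => ->; ring.
have ae : aeq (F t - F (t + s)) (r - s *: T (t + s) g).
  apply: filterS2 (filterI Fae Fae') rE => x [/(_ I) h1 /(_ I) h2] /(_ I) h3 _.
  by rewrite -h3 !subfE -h1 -h2.
rewrite (Fgen' _ dE) L2ipC (L2ip_aeq (Edom_L2 mu dE) (L2B rL sgL) gL' ae).
rewrite L2ipBl // L2ipZl //.
have h0 := L2ip_ge0 mu (T (t + s) g).
have h2 : 0 <= s * L2ip mu (T (t + s) g) (T (t + s) g) by rewrite mulr_ge0 // ltW.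
have h1 : L2ip mu r (T (t + s) g) <= s * step_error s * 'N g.
  apply: le_trans (ler_norm _) _.
  apply: le_trans (cauchy_schwarz rL gL') _.
  by apply: ler_pM; rewrite ?sqrtr_ge0 // heat_norm.
by lra.
Qed.

End Orbit.

(** An orbit from the form domain is the L2 limit, with controlled energies, of
orbits from the domain of the generator. *)
Lemma heat_approx (f w : X -> R) t : Edom f -> 0 <= t -> Edom w -> aeq w (T t f) ->
  forall n, exists f' g' w', [/\ Edom f', generator mu f' g', En f' <= En f,
    'N (f - f') <= 2^-1 ^+ n & [/\ Edom w', aeq w' (T t f') & 'N (w' - w) <= 2^-1 ^+ n]].
Proof.
move=> fE t0 wE wae n.
have n0 : (0 : R) < 2^-1 ^+ n by rewrite exprn_gt0 // invr_gt0.
have [f' [g' [fE' gL' fg' Ef' Nf']]] := generator_approx mu_full fE n0.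
have fL := Edom_L2 mu fE; have fL' := Edom_L2 mu fE'.
have [_ [w' [wE' wae' _]]] := generator_heat t0 fL' fg'.
have TfL := heat_L2 T_heat t0 fL; have TfL' := heat_L2 T_heat t0 fL'.
exists f', g', w'; split=> //; split=> //.
  by apply: filterS wae' => x h _; rewrite (h I).
rewrite (@L2norm_aeq _ _ _ _ (T t f' - T t f)).
- apply: le_trans (heat_dist t0 fL' fL) _; rewrite L2norm_distC //.
- by apply: Edom_L2; apply: EdomB.
- exact: L2B.
- by apply: filterS2 wae wae' => x h1 h2 _; rewrite !subfE (h1 I) (h2 I).
Qed.

(** The energy of the approximating orbits decreases, and lower semicontinuity
carries the bound to their pointwise limit. *)
Lemma heat_energy_le (f w : X -> R) t : Edom f -> 0 <= t -> Edom w ->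
  aeq w (T t f) -> En w <= En f.
Proof.
move=> fE t0 wE wae.
have /choice [f' /choice [g' /choice [w' P]]] := heat_approx fE t0 wE wae.
have w'E n : Edom (w' n) by have [_ _ _ _ []] := P n.
have w'M n : En (w' n) <= En f.
  have [fE' fg' Ef' _ [wE' wae' _]] := P n; apply: le_trans Ef'.
  exact (energy_orbit_le (Edom_L2 mu fE') fg' fE' t0 wE' wae').
have w'N : 'N (w' n - w) @[n --> \oo] --> 0.
  apply: (@squeeze_cvgr _ _ _ _ (fun=> 0) (fun n => 2^-1 ^+ n)).
  - by apply: nearW => n; rewrite sqrtr_ge0; have [_ _ _ _ []] := P n.
  - exact: cvg_cst.
  - exact: cvg_half_pow.
apply: energy_form_le => // m.
apply: (energy_lsc w'E w'M (Edom_continuous wE)).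
exact: (bounded_energy_cvg_pointwise mu_full w'E w'M wE w'N).
Qed.

(** The deficit of f vanishes and the norm of the deficit does not increase along
the approximating orbits, so the deficit of w is 0 in L2; as w is continuous and
mu has full support, it vanishes everywhere. *)
Lemma heat_lower_bound (f w : X -> R) t c : Edom f -> 0 <= t -> Edom w ->
  aeq w (T t f) -> (forall x, c <= f x) -> forall x, c <= w x.
Proof.
move=> fE t0 wE wae fc.
have fL := Edom_L2 mu fE; have wL := Edom_L2 mu wE.
have pf0 : deficit c f = 0.
  by apply/funext => x; rewrite /deficit max_r // subr_le0 fc.
have Npf0 : 'N (deficit c f) = 0.
  by rewrite pf0 -(scale0r (0 : X -> R)) L2normZ ?normr0 ?mul0r //; exact: L2_0.
have Np n : 'N (deficit c w) <= 2^-1 ^+ n *+ 2.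
  have [f' [g' [w' [fE' fg' _ Nf' [wE' wae' Nw']]]]] := heat_approx fE t0 wE wae n.
  have fL' := Edom_L2 mu fE'; have wL' := Edom_L2 mu wE'.
  have TfL' := heat_L2 T_heat t0 fL'.
  apply: le_trans (L2norm_deficit_dist c wL wL') _; rewrite mulr2n.
  apply: lerD; last by rewrite L2norm_distC.
  rewrite (@L2norm_aeq _ _ _ _ (deficit c (T t f'))).
  - apply: le_trans (deficit_orbit_le fL' fg' c t0) _.
    apply: le_trans (L2norm_deficit_dist c fL' fL) _.
    by rewrite Npf0 add0r L2norm_distC.
  - exact: L2_deficit.
  - exact: L2_deficit.
  - by apply: filterS wae' => x h _; rewrite /deficit (h I).
have Np0 : 'N (deficit c w) <= 0.
  have h : 2^-1 ^+ n *+ 2 @[n --> \oo] --> (0 : R) *+ 2.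
    by apply: cvgMn; exact: cvg_half_pow.
  rewrite mul0rn in h; rewrite -(cvg_lim _ h) //.
  by apply: limr_ge; [exact: cvgP h|exact: nearW].
move=> x; rewrite leNgt; apply/negP => wx.
pose a := (c - w x) / 2; have a0 : 0 < a by rewrite divr_gt0 // subr_gt0.
pose U := [set y | a < deficit c w y].
have oU : open U.
  apply: (@open_comp _ _ (deficit c w) [set r : R | a < r]); last exact: open_gt.
  by move=> y _; apply: continuous_deficit; apply: Edom_continuous.
have Ux : U x by rewrite /U /= /deficit lt_max /a; apply/orP; left; lra.
have mU : 0 < fine (mu U) by apply: mu_open_gt0 => //; exists x.
have aU y : U y -> a <= `|deficit c w y|.
  by move=> /ltW Uy; apply: le_trans Uy (ler_norm _).
have := L2ip_ge_open (L2_deficit c wL) oU (ltW a0) aU.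
rewrite leNgt => /negP; apply.
have N0 : 'N (deficit c w) = 0 by apply/eqP; rewrite eq_le Np0 sqrtr_ge0.
by rewrite -L2norm_sqr N0 expr0n; exact: mulr_gt0 (exprn_gt0 2 a0) mU.
Qed.

End Semigroup.

(** * Gradient estimates for the logarithmic transform *)

Section RealFunctions.
Variable R : realType.
Implicit Types x y M m : R.

Lemma expR_lipschitz M x y : x <= M -> y <= M ->
  `|expR x - expR y| <= expR M * `|x - y|.
Proof.
wlog yx : x y / y <= x => [h xM yM|xM yM].
  have [yx|xy] := orP (le_total y x); first exact: h.
  by rewrite distrC (distrC x); apply: h.
rewrite !ger0_norm ?subr_ge0 ?ler_expR //.
apply: (@le_trans _ _ (expR x * (x - y))); last first.
  by rewrite ler_wpM2r ?subr_ge0 // ler_expR.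
have := expR_ge1Dx (y - x); rewrite -(ler_pM2l (expR_gt0 x)) -expRD.
by rewrite (addrC x) subrK; lra.
Qed.

Lemma ln_lipschitz m x y : 0 < m -> m <= x -> m <= y ->
  `|ln x - ln y| <= m^-1 * `|x - y|.
Proof.
move=> m0; wlog yx : x y / y <= x => [h mx my|mx my].
  have [yx|xy] := orP (le_total y x); first exact: h.
  by rewrite distrC (distrC x); apply: h.
have x0 := lt_le_trans m0 mx; have y0 := lt_le_trans m0 my.
rewrite !ger0_norm ?subr_ge0 ?ler_ln //.
rewrite -ln_div ?posrE //.
have h : ln (x / y) <= x / y - 1.
  by have := expR_ge1Dx (ln (x / y)); rewrite lnK ?posrE ?divr_gt0 //; lra.
apply: le_trans h _; rewrite (_ : x / y - 1 = y^-1 * (x - y)); last by field; rewrite gt_eqF.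
by rewrite ler_wpM2r ?subr_ge0 // lef_pV2 ?posrE.
Qed.

Lemma inv_lipschitz m x y : 0 < m -> m <= x -> m <= y ->
  `|x^-1 - y^-1| <= m^-1 ^+ 2 * `|x - y|.
Proof.
move=> m0 mx my; have x0 := lt_le_trans m0 mx; have y0 := lt_le_trans m0 my.
rewrite (_ : x^-1 - y^-1 = x^-1 * y^-1 * (y - x)); last first.
  by field; rewrite !gt_eqF.
rewrite normrM distrC ler_wpM2r // ger0_norm; last first.
  by rewrite mulr_ge0 ?invr_ge0 ?(ltW x0) ?(ltW y0).
by rewrite expr2 ler_pM ?invr_ge0 ?(ltW x0) ?(ltW y0) // lef_pV2 ?posrE.
Qed.

Lemma le_expR x : x <= expR x.
Proof. by have := expR_ge1Dx x; lra. Qed.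

End RealFunctions.

Section Gradient.
Variables (R : realType) (K : gasket R) (H : vector_fields K).
Local Notation X := (gpoint K).
Implicit Types (f g : X -> R).
Local Notation En f := (energy_form f f).

Lemma field_span_du f : Edom f -> field_span (du f).
Proof.
move=> fE; exists 1%N, (fun=> 1), (fun=> (fun=> 1)), (fun=> f).
split=> [i|]; first by split=> //; apply: Edom_cst.
rewrite big_ord1 scale1r; apply/funext => z /=.
by rewrite /mean -[X in X = _]mul1r; congr (_ * _); field.
Qed.

Lemma grad_linear c f g : Edom f -> Edom g ->
  grad H (c *: f + g) = c *: grad H f + grad H g.
Proof.
move=> fE gE; rewrite /grad -vf_class_linear; try exact: field_span_du.
congr vf_class; apply/funext => z; rewrite /du !addfE !scalefE; ring.
Qed.

Lemma gradB f g : Edom f -> Edom g -> grad H (f - g) = grad H f - grad H g.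
Proof. by move=> fE gE; rewrite addrC -scaleN1r grad_linear // scaleN1r addrC. Qed.

Lemma norm_grad f : Edom f -> `|grad H f| = Num.sqrt (En f).
Proof.
move=> fE; have sE := field_span_du fE.
by rewrite -[LHS]ger0_norm // -sqrtr_sqr -vf_ip_norm /grad vf_class_ip.
Qed.

Lemma norm_grad_le f g : Edom f -> Edom g -> En f <= En g -> `|grad H f| <= `|grad H g|.
Proof. by move=> fE gE fg; rewrite !norm_grad // ler_wsqrtr. Qed.

(** The chain rule as an inequality; continuity of F follows from that of f. *)
Lemma grad_lipschitz (F : X -> R) f L : 0 <= L -> Edom f ->
  (forall x y, `|F x - F y| <= L * `|f x - f y|) ->
  Edom F /\ `|grad H F| <= L * `|grad H f|.
Proof.
move=> L0 fE FL.
have cF : continuous F.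
  apply: continuous_by_open => x e e0.
  have L1 : 0 < L + 1 by rewrite ltr_wpDl.
  have : nbhs x [set y | `|f x - f y| < e / (L + 1)].
    have /cvgrPdist_lt := @Edom_continuous _ _ _ fE x; apply.
    by rewrite divr_gt0.
  rewrite nbhsE => -[U [oU Ux] Ue]; exists U => // y /Ue /= yU.
  apply: le_trans (FL x y) _.
  rewrite ltr_pdivlMr // in yU; apply: le_trans (ltW yU).
  by rewrite mulrC ler_wpM2l // lerDl.
have dom x y : (F x - F y) ^+ 2 <= L ^+ 2 * (f x - f y) ^+ 2 + 0 * (f x - f y) ^+ 2.
  rewrite mul0r addr0 -exprMn -ler_sqrt ?sqr_ge0 // !sqrtr_sqr normrM (ger0_norm L0).
  exact: FL.
have [FE EF] := energy_dominated cF fE fE (sqr_ge0 L) (lexx 0) dom.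
split=> //; rewrite !norm_grad // -{1}(ger0_norm L0) -sqrtr_sqr -sqrtrM ?sqr_ge0 //.
by apply: ler_wsqrtr; rewrite mul0r addr0 in EF.
Qed.

(** The product rule as an inequality, at the level of increments. *)
Lemma grad_mul f g A B : Edom f -> Edom g ->
  (forall x, `|f x| <= A) -> (forall x, `|g x| <= B) ->
  Edom (f \* g) /\ `|grad H (f \* g)| <= 2 * (A * `|grad H g| + B * `|grad H f|).
Proof.
move=> fE gE fA gB.
have A0 : 0 <= A := le_trans (normr_ge0 _) (fA point).
have B0 : 0 <= B := le_trans (normr_ge0 _) (gB point).
have cfg : continuous (f \* g) by apply: continuous_mul; apply: Edom_continuous.
have dom x y : ((f \* g) x - (f \* g) y) ^+ 2 <=
    2 * A ^+ 2 * (g x - g y) ^+ 2 + 2 * B ^+ 2 * (f x - f y) ^+ 2.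
  have hf : f x ^+ 2 <= A ^+ 2 by rewrite -ler_sqrt ?sqr_ge0 // !sqrtr_sqr (ger0_norm A0).
  have hg : g y ^+ 2 <= B ^+ 2 by rewrite -ler_sqrt ?sqr_ge0 // !sqrtr_sqr (ger0_norm B0).
  apply: (@le_trans _ _ (2 * f x ^+ 2 * (g x - g y) ^+ 2 + 2 * g y ^+ 2 * (f x - f y) ^+ 2)).
    rewrite /= -subr_ge0.
    by rewrite (_ : _ - _ = (f x * (g x - g y) - g y * (f x - f y)) ^+ 2) ?sqr_ge0 //; ring.
  by apply: lerD; rewrite ler_wpM2r ?sqr_ge0 // ler_wpM2l.
have A2 : 0 <= 2 * A ^+ 2 by rewrite mulr_ge0 // sqr_ge0.
have B2 : 0 <= 2 * B ^+ 2 by rewrite mulr_ge0 // sqr_ge0.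
have [fgE Efg] := energy_dominated cfg gE fE A2 B2 dom.
split=> //; rewrite norm_grad //.
have Nf0 := normr_ge0 (grad H f); have Ng0 := normr_ge0 (grad H g).
set r := 2 * _; have r0 : 0 <= r by rewrite mulr_ge0 // addr_ge0 // mulr_ge0.
rewrite -[r]ger0_norm // -sqrtr_sqr ler_wsqrtr //; apply: le_trans Efg _.
have sq h : Edom h -> En h = `|grad H h| ^+ 2.
  by move=> hE; rewrite norm_grad // sqr_sqrtr // energy_form_ge0.
have p0 : 0 <= A * `|grad H g| by rewrite mulr_ge0.
have s0 : 0 <= B * `|grad H f| by rewrite mulr_ge0.
rewrite (sq _ fE) (sq _ gE) /r -subr_ge0.
set p := A * `|grad H g| in p0 *; set s := B * `|grad H f| in s0 *.
rewrite (_ : _ - _ = 2 * p ^+ 2 + 2 * s ^+ 2 + 8 * (p * s)); last by rewrite /p /s; ring.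
by rewrite !addr_ge0 // mulr_ge0 // ?sqr_ge0 // mulr_ge0.
Qed.

Lemma sup_le_grad f x0 x : Edom f -> f x0 = 0 ->
  `|f x| <= 2 * osc_const R * `|grad H f|.
Proof.
by move=> fE f0; have := energy_osc x x0 fE; rewrite f0 subr0 norm_grad.
Qed.

End Gradient.

Section HeatBounds.
Variables (R : realType) (K : gasket R).
Variable mu : {finite_measure set (borel K) -> \bar R}.
Hypothesis mu_full : full_support mu.
Local Notation X := (gpoint K).
Local Notation aeq f g := ((f : borel K -> R) = g %[ae mu]).
Variable T : R -> (X -> R) -> X -> R.
Hypothesis T_heat : heat_semigroup mu T.
Implicit Types f w : X -> R.

Lemma heat_upper_bound f w (t c : R) : Edom f -> 0 <= t -> Edom w ->
  aeq w (T t f) -> (forall x, f x <= c) -> forall x, w x <= c.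
Proof.
move=> fE t0 wE wae fc x; have fL := Edom_L2 mu fE.
have e1 := heatB T_heat t0 (L2_0 mu) fL.
have e2 := heatB T_heat t0 (L2_0 mu) (L2_0 mu).
rewrite subrr in e2.
have NfE : Edom (0 - f) by apply: EdomB => //; apply: Edom_cst.
have NwE : Edom (0 - w) by apply: EdomB => //; apply: Edom_cst.
have Nae : aeq (0 - w) (T t (0 - f)).
  apply: filterS2 wae (filterI e1 e2) => y h [/(_ I) h1 /(_ I) h2] _.
  by move: h1 h2; rewrite !subfE (h I) => -> ->; rewrite subrr.
have Nfc y : - c <= (0 - f) y by rewrite sub0r lerN2.
have := heat_lower_bound mu_full T_heat NfE t0 NwE Nae Nfc x.
by rewrite sub0r lerN2.
Qed.

Lemma heat_sup_bound f w (t c : R) : Edom f -> 0 <= t -> Edom w ->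
  aeq w (T t f) -> (forall x, `|f x| <= c) -> forall x, `|w x| <= c.
Proof.
move=> fE t0 wE wae fc x; rewrite ler_norml.
apply/andP; split.
  apply: (heat_lower_bound mu_full T_heat fE t0 wE wae) => y.
  by have := fc y; rewrite ler_norml => /andP[].
apply: (heat_upper_bound fE t0 wE wae) => y.
by have := fc y; rewrite ler_norml => /andP[].
Qed.

End HeatBounds.

Section ColeHopf.
Variables (R : realType) (K : gasket R).
Variable mu : {finite_measure set (borel K) -> \bar R}.
Hypothesis mu_full : full_support mu.
Variable H : vector_fields K.
Local Notation X := (gpoint K).
Local Notation aeq f g := ((f : borel K -> R) = g %[ae mu]).
Local Notation N f := `|grad H f|.
Variable T : R -> (X -> R) -> X -> R.
Hypothesis T_heat : heat_semigroup mu T.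
Implicit Types h w : X -> R.

Local Notation C := (2 * osc_const R).

Lemma C_gt0 : 0 < C.
Proof. by rewrite mulr_gt0 // osc_const_gt0. Qed.

(** The value at time 0 of the heat flow in the Cole-Hopf formula. *)
Definition cole_hopf_datum h : X -> R := fun x => expR (- (h x / 2)).

Lemma datum_bounds h (M : R) : (forall x, `|h x| <= M) ->
  forall x, expR (- (M / 2)) <= cole_hopf_datum h x <= expR (M / 2).
Proof.
move=> hM x; rewrite /cole_hopf_datum !ler_expR.
by have := hM x; rewrite ler_norml => /andP[h1 h2]; apply/andP; split; lra.
Qed.

Lemma grad_datum h (M : R) : Edom h -> (forall x, `|h x| <= M) ->
  Edom (cole_hopf_datum h) /\ N (cole_hopf_datum h) <= expR (M / 2) / 2 * N h.
Proof.
move=> hE hM; apply: (@grad_lipschitz _ _ H _ h (expR (M / 2) / 2)) => //.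
move=> x y; apply: le_trans (@expR_lipschitz _ (M / 2) _ _ _ _) _.
- by have := hM x; rewrite ler_norml => /andP[]; lra.
- by have := hM y; rewrite ler_norml => /andP[]; lra.
rewrite -mulrA ler_wpM2l ?expR_ge0 //.
rewrite (_ : _ - _ = (h y - h x) / 2); last by field.
by rewrite normrM distrC mulrC (ger0_norm (_ : 0 <= 2^-1)) // invr_ge0.
Qed.

(** What the maximum principle and the energy decay say of the heat flow at time t
started from a datum whose exponent is bounded by M / 2. *)
Record cole_hopf_state (h : X -> R) (M t : R) (w : X -> R) : Prop := ColeHopfState {
  state_Edom : Edom w ;
  state_heat : aeq w (T t (cole_hopf_datum h)) ;
  state_lower : forall x, expR (- (M / 2)) <= w x ;
  state_upper : forall x, w x <= expR (M / 2) ;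
  state_norm : N w <= expR (M / 2) / 2 * N h
}.

Lemma cole_hopfP h (u : R -> H) (M t : R) : Edom h -> (forall x, `|h x| <= M) -> 0 <= t ->
  cole_hopf mu T h u -> exists2 w, cole_hopf_state h M t w &
    u t = (- 2) *: grad H (fun x => ln (w x)).
Proof.
move=> hE hM t0 /(_ t t0) [w [wE wae uw]]; exists w => //.
have [iE iN] := grad_datum hE hM; have ib := datum_bounds hM.
split=> //.
- by apply: (heat_lower_bound mu_full T_heat iE t0 wE wae) => x; have /andP[] := ib x.
- by apply: (heat_upper_bound mu_full T_heat iE t0 wE wae) => x; have /andP[] := ib x.
- apply: le_trans iN; apply: norm_grad_le => //.
  exact: (heat_energy_le mu_full T_heat iE t0 wE wae).
Qed.

Lemma ln_state h (M t : R) w : cole_hopf_state h M t w ->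
  Edom (fun x => ln (w x)) /\ N (fun x => ln (w x)) <= expR (M / 2) * N w.
Proof.
move=> [wE _ wl _ _]; apply: (@grad_lipschitz _ _ H _ w (expR (M / 2))) => //.
move=> x y; rewrite -[expR (M / 2)]invrK -expRN.
by apply: ln_lipschitz => //; apply: expR_gt0.
Qed.

(** The logarithm costs a factor exp(M/2) above the lower bound for w, and the
exponential in the datum another one, with M = C |grad h|. *)
Lemma burgers_bound h (u : R -> H) x0 (t : R) : Edom h -> h x0 = 0 -> 0 <= t -> cole_hopf mu T h u ->
  `|u t| <= N h * expR (C * N h).
Proof.
move=> hE h0 t0 ch; have hM x := sup_le_grad H x hE h0.
have [w st ->] := cole_hopfP hE hM t0 ch.
have [_ lnN] := ln_state st; have := state_norm st.
rewrite normrZ normrN ger0_norm //.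
set e := expR (C * N h / 2) in lnN * => wN.
have e0 : 0 <= e by apply: expR_ge0.
have -> : expR (C * N h) = e * e by rewrite -expRD; congr expR; field.
have := ler_wpM2l e0 wN; lra.
Qed.

(** The difference of logarithms is the logarithm of the quotient
w / w' = 1 + (w - w') / w', to which the product and Lipschitz rules apply; the
maximum principle and the energy decay control w - w' by its initial value. *)
Lemma ln_state_dist h h' (s d t : R) w w' : Edom h -> Edom h' -> 0 <= t ->
  N h <= s -> N h' <= s -> d = N (h - h') -> d <= s ->
  (forall x, `|h x| <= C * s) -> (forall x, `|h' x| <= C * s) ->
  (forall x, `|h x - h' x| <= C * d) ->
  cole_hopf_state h (C * s) t w -> cole_hopf_state h' (C * s) t w' ->
  N ((fun x => ln (w x)) - (fun x => ln (w' x))) <=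
  2 * (3 * C + 2) * expR (5 * (C * s) + s) * d.
Proof.
move=> hE hE' t0 hs hs' dE ds hM hM' kM st st'.
have C0 := ltW C_gt0.
have d0 : 0 <= d by rewrite dE.
have s0 : 0 <= s by apply: le_trans ds.
have [iE _] := grad_datum hE hM; have [iE' iN'] := grad_datum hE' hM'.
have ib' := datum_bounds hM'.
set b := expR (C * s / 2) in iN'.
pose B := expR (C * s); have BE : B = b * b by rewrite -expRD /B; congr expR; field.
have b1 : 1 <= b by rewrite -expR0 ler_expR divr_ge0 // mulr_ge0.
have b0 : 0 <= b by apply: le_trans b1.
have bB : b <= B by rewrite BE ler_peMl.
have B1 : 1 <= B := le_trans b1 bB.
have B0 : 0 <= B by apply: le_trans B1.
have es : s <= expR s := le_expR s.
have e0 := expR_ge0 s; set e := expR s in es e0.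
have e1 : 1 <= e by rewrite -expR0 ler_expR.
have kE := EdomB hE hE'.
(* G is the ratio of the initial values, minus one. *)
pose G : X -> R := fun x => cole_hopf_datum (h - h') x - 1.
have [ikE ikN] := @grad_datum (h - h') (C * d) kE kM.
have edb : expR (C * d / 2) <= b.
  by rewrite ler_expR ler_wpM2r ?invr_ge0 // ler_wpM2l.
have [GE GN] : Edom G /\ N G <= b * d.
  have := @grad_lipschitz _ _ H G (cole_hopf_datum (h - h')) 1 ler01 ikE.
  case=> [x y|GE GN]; first by rewrite mul1r /G opprB addrA addrNK.
  split=> //; apply: le_trans GN _; rewrite mul1r; apply: le_trans ikN _.
  rewrite -dE ler_wpM2r // ler_pdivrMr //.
  by apply: le_trans edb _; rewrite ler_peMr // ler1n.
have Gb x : `|G x| <= b * (C * d).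
  rewrite /G /cole_hopf_datum -[X in _ - X]expR0.
  apply: le_trans (@expR_lipschitz _ (C * d / 2) _ _ _ _) _.
  - by have := kM x; rewrite -subfE ler_norml => /andP[]; lra.
  - by rewrite divr_ge0 // mulr_ge0.
  apply: ler_pM; rewrite ?expR_ge0 // subr0 normrN normrM.
  rewrite (ger0_norm (_ : 0 <= 2^-1)) ?invr_ge0 //.
  apply: le_trans (kM x); rewrite subfE.
  by rewrite ler_pdivrMr // ler_peMr // ler1n.
pose D0 := cole_hopf_datum h - cole_hopf_datum h'.
have D0E : D0 = cole_hopf_datum h' \* G.
  apply/funext => x; rewrite /D0 subfE /= /G /cole_hopf_datum mulrBr mulr1 -expRD subfE.
  by congr (expR _ - _); field.
have i'b x : `|cole_hopf_datum h' x| <= b.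
  by rewrite ger0_norm ?expR_ge0 //; have /andP[] := ib' x.
have [_] := grad_mul H iE' GE i'b Gb; rewrite -D0E => D0N.
have D0b x : `|D0 x| <= B * (C * d).
  by rewrite D0E /= normrM BE -mulrA ler_pM.
have DD0 : Edom D0 by apply: EdomB.
have [wE wae wl wu wN] := st; have [wE' wae' wl' wu' wN'] := st'.
pose D := w - w'.
have DE : Edom D by apply: EdomB.
have Dae : aeq D (T t D0).
  have := heatB T_heat t0 (Edom_L2 mu iE) (Edom_L2 mu iE').
  apply: filterS3 wae wae' => x h1 h2 h3 _.
  by rewrite /D /D0 (h3 I) !subfE (h1 I) (h2 I).
have Db x : `|D x| <= B * (C * d) := heat_sup_bound mu_full T_heat DD0 t0 DE Dae D0b x.
have DN : N D <= N D0.
  by apply: norm_grad_le => //; apply: (heat_energy_le mu_full T_heat DD0 t0 DE Dae).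
pose V : X -> R := fun x => (w' x)^-1.
have bV : (expR (- (C * s / 2)))^-1 = b by rewrite expRN invrK.
have w'0 x : 0 < w' x := lt_le_trans (expR_gt0 _) (wl' x).
have w0 x : 0 < w x := lt_le_trans (expR_gt0 _) (wl x).
have Vb x : `|V x| <= b.
  by rewrite ger0_norm ?invr_ge0 ?(ltW (w'0 x)) // -bV lef_pV2 ?posrE ?expR_gt0.
have [VE VN] : Edom V /\ N V <= b ^+ 2 * N w'.
  apply: (@grad_lipschitz _ _ H _ w' (b ^+ 2)) => //; first exact: sqr_ge0.
  move=> x y; rewrite -bV; apply: inv_lipschitz => //; exact: expR_gt0.
have [QE QN] := grad_mul H DE VE Db Vb.
have Q1 x : w x / w' x = 1 + (D \* V) x.
  by rewrite /= /D /V subfE; field; rewrite gt_eqF.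
have Ql x : B^-1 <= w x / w' x.
  rewrite BE invfM ler_pM ?invr_ge0 //; first by rewrite -bV invrK.
  by rewrite lef_pV2 ?posrE // (lt_le_trans _ b1).
have [_ LN] : Edom ((fun x => ln (w x)) - (fun x => ln (w' x))) /\
   N ((fun x => ln (w x)) - (fun x => ln (w' x))) <= B * N (D \* V).
  apply: (@grad_lipschitz _ _ H _ (D \* V) B) => // x y.
  have lnQ z : ln (w z) - ln (w' z) = ln (w z / w' z) by rewrite ln_div ?posrE.
  rewrite !subfE !lnQ.
  have Bi : 0 < B^-1 by rewrite invr_gt0 expR_gt0.
  apply: le_trans (ln_lipschitz Bi (Ql x) (Ql y)) _.
  by rewrite invrK !Q1 opprD addrACA subrr add0r.
apply: le_trans LN _.
have -> : expR (5 * (C * s) + s) = B ^+ 5 * e by rewrite expRD expRM_natl.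
have iN2 : N (cole_hopf_datum h') <= b * e.
  apply: le_trans iN' _; apply: ler_pM => //; first by rewrite divr_ge0.
    by rewrite ler_pdivrMr // ler_peMr // ler1n.
  exact: le_trans es.
have wN2 : N w' <= b * e.
  apply: le_trans wN' _; rewrite -/b; apply: ler_pM => //; first by rewrite divr_ge0.
    by rewrite ler_pdivrMr // ler_peMr // ler1n.
  exact: le_trans es.
have VN2 : N V <= b ^+ 2 * (b * e).
  by apply: le_trans VN _; rewrite ler_wpM2l ?sqr_ge0.
have D0N2 : N D0 <= 2 * (1 + C) * (b ^+ 2 * e * d).
  apply: le_trans D0N _; rewrite -[2 * (1 + C) * _]mulrA ler_wpM2l //.
  have h1 : b * N G <= b ^+ 2 * e * d.
    apply: le_trans (ler_wpM2l b0 GN) _; rewrite mulrA -expr2 ler_wpM2r //.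
    by rewrite ler_peMr ?sqr_ge0.
  have h2 : b * (C * d) * N (cole_hopf_datum h') <= C * (b ^+ 2 * e * d).
    have bCd := mulr_ge0 b0 (mulr_ge0 C0 d0).
    apply: le_trans (ler_wpM2l bCd iN2) _.
    by rewrite le_eqVlt; apply/orP; left; apply/eqP; ring.
  by rewrite [leRHS]mulrDl mul1r; apply: lerD.
have QN2 : N (D \* V) <= 2 * (3 * C + 2) * (b ^+ 5 * e * d).
  apply: le_trans QN _; rewrite -[2 * (3 * C + 2) * _]mulrA ler_wpM2l //.
  have h1 : B * (C * d) * N V <= C * (b ^+ 5 * e * d).
    have BCd := mulr_ge0 B0 (mulr_ge0 C0 d0).
    apply: le_trans (ler_wpM2l BCd VN2) _.
    by rewrite BE le_eqVlt; apply/orP; left; apply/eqP; ring.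
  have h2 : b * N D <= 2 * (1 + C) * (b ^+ 5 * e * d).
    apply: le_trans (ler_wpM2l b0 (le_trans DN D0N2)) _.
    rewrite mulrCA ler_wpM2l ?mulr_ge0 ?addr_ge0 //.
    rewrite (_ : b * _ = b ^+ 3 * e * d); last by ring.
    by rewrite ler_wpM2r // ler_wpM2r // ler_weXn2l.
  have e5 : 0 <= b ^+ 5 * e * d by rewrite !mulr_ge0 ?exprn_ge0.
  by move: h1 h2; lra.
apply: le_trans (ler_wpM2l B0 QN2) _.
have K0 : 0 <= 2 * (3 * C + 2) by rewrite mulr_ge0 // addr_ge0 // mulr_ge0.
rewrite mulrCA -[leRHS]mulrA ler_wpM2l //.
rewrite (_ : B * _ = b ^+ 7 * e * d); last by rewrite BE; ring.
rewrite (_ : B ^+ 5 = b ^+ 10); last by rewrite BE; ring.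
by rewrite ler_wpM2r // ler_wpM2r // ler_weXn2l.
Qed.

End ColeHopf.

Unset Implicit Arguments.

Theorem corollary3p1 (R : realType) (K : gasket R)
    (mu : {finite_measure set (borel K) -> \bar R})
    (mu_atom_free : atom_free mu) (mu_full_support : full_support mu)
    (H : vector_fields K)
    (T : R -> (gpoint K -> R) -> gpoint K -> R) (T_heat : heat_semigroup mu T) :
  (exists c1 c2 : R, [/\ 0 < c1, 0 < c2 &
    forall (x0 : gpoint K) (h0 : gpoint K -> R) (u : R -> H),
      Edom h0 -> h0 x0 = 0 ->
      burgers_solution mu (grad H h0) u -> cole_hopf mu T h0 u ->
      (ereal_sup [set (`|u t|)%:E | t in [set t : R | (0 < t)%R]]
       <= (c1 * `|grad H h0| * expR (c2 * `|grad H h0|))%:E)%E])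
  /\
  (exists c3 c4 : R, [/\ 0 < c3, 0 < c4 &
    forall (x0 : gpoint K) (h0 h0' : gpoint K -> R) (u u' : R -> H),
      Edom h0 -> h0 x0 = 0 ->
      burgers_solution mu (grad H h0) u -> cole_hopf mu T h0 u ->
      Edom h0' -> h0' x0 = 0 ->
      burgers_solution mu (grad H h0') u' -> cole_hopf mu T h0' u' ->
      (ereal_sup [set (`|u t - u' t|)%:E | t in [set t : R | (0 < t)%R]]
       <= (c3 * (`|grad H h0| + 1) ^+ 2
             * expR (c4 * (`|grad H h0| + `|grad H h0'|))
             * `|grad H h0 - grad H h0'|)%:E)%E]).
Proof.
have C0 : 0 < 2 * osc_const R by rewrite mulr_gt0 // osc_const_gt0.
split.
  exists 1, (2 * osc_const R); split=> // x0 h0 u hE hx _ ch.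
  apply: ge_ereal_sup => _ [t /= t0 <-]; rewrite lee_fin mul1r.
  exact: (burgers_bound mu_full_support T_heat hE hx (ltW t0) ch).
set C := 2 * osc_const R in C0 *.
exists (4 * (3 * C + 2)), (5 * C + 1); split.
- by rewrite mulr_gt0 // addr_gt0 // mulr_gt0.
- by rewrite addr_gt0 // mulr_gt0.
move=> x0 h h' u u' hE hx _ ch hE' hx' _ ch'.
apply: ge_ereal_sup => _ [t /= /ltW t0 <-]; rewrite lee_fin.
have hM x := sup_le_grad H x hE hx; have hM' x := sup_le_grad H x hE' hx'.
set s := `|grad H h| + `|grad H h'|.
have hs : `|grad H h| <= s by rewrite lerDl.
have hs' : `|grad H h'| <= s by rewrite lerDr.
have hMs x : `|h x| <= C * s by apply: le_trans (hM x) _; rewrite ler_pM2l.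
have hMs' x : `|h' x| <= C * s by apply: le_trans (hM' x) _; rewrite ler_pM2l.
have kE := EdomB hE hE'.
have k0 : (h - h') x0 = 0 by rewrite subfE hx hx' subrr.
have kM x := sup_le_grad H x kE k0.
have ds : `|grad H (h - h')| <= s by rewrite gradB // ler_normB.
have [w st ->] := cole_hopfP mu_full_support T_heat hE hMs t0 ch.
have [w' st' ->] := cole_hopfP mu_full_support T_heat hE' hMs' t0 ch'.
have [lE _] := ln_state st; have [lE' _] := ln_state st'.
rewrite -scalerBr -gradB // normrZ normrN ger0_norm //.
have := ln_state_dist mu_full_support T_heat hE hE' t0 hs hs' erefl ds hMs hMs' kM st st'.
rewrite -gradB // -/C; set d := `|grad H (h - h')|; set n := `|grad H _| => le.
have d0 : 0 <= d := normr_ge0 _.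
have -> : (5 * C + 1) * s = 5 * (C * s) + s by ring.
have e0 := expR_ge0 (5 * (C * s) + s).
apply: (@le_trans _ _ (4 * (3 * C + 2) * 1 * expR (5 * (C * s) + s) * d)).
  by move: le; lra.
rewrite ler_wpM2r // ler_wpM2r // ler_wpM2l //.
  by rewrite mulr_ge0 // addr_ge0 // mulr_ge0 // ltW.
by rewrite exprn_ege1 // lerDr.
Qed.
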